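(* Let $c_\alpha,c_z\ge0$, $\ell_c>0$, $\ell_J\ge 0$ and $c_0>0$ be constants, and let $w$ be a graphon with graphon operator $\mathbf{W}$. Assume: (i) $|b(\alpha,z)-b(\alpha',z')|^2\le c_\alpha|\alpha-\alpha'|^2+c_z|z-z'|^2$ for all $(\alpha,z),(\alpha',z')\in A\times\mathbb{R}$, and $\mathbb{E}[\xi_0^2]<\infty$; (ii) for each $z\in\mathbb{R}$, $\alpha\mapsto\mathcal{J}(\alpha,z)$ is continuously differentiable on $A$ and, for all $\alpha,\alpha'\in A$, $z\in\mathbb{R}$ and $\epsilon\in[0,1]$, $\mathcal{J}(\epsilon\alpha+(1-\epsilon)\alpha',z)\le\epsilon\mathcal{J}(\alpha,z)+(1-\epsilon)\mathcal{J}(\alpha',z)-\frac{\ell_c}{2}\epsilon(1-\epsilon)|\alpha-\alpha'|^2$; (iii) $|\partial_\alpha\mathcal{J}(\alpha,z')-\partial_\alpha\mathcal{J}(\alpha,z)|\le\ell_J|z'-z|$ for all $\alpha\in A$, $z,z'\in\mathbb{R}$; (iv) $|b(\alpha,z)|\le c_0$ for all $\alpha\in A$, $z\in\mathbb{R}$; (v) $\sqrt{c_z}\,\|\mathbf{W}\|<1$. Then the graphon game with graphon $w$ has at least one Nash equilibrium.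
   Context: $I=[0,1]$ with Lebesgue measure; $L^2(I)$ is the usual real Lebesgue space. $A\subset\mathbb{R}$ is a nonempty closed convex set of actions, and $\mathbb{A}$ is the set of $\boldsymbol{\alpha}\in L^2(I)$ with values in $A$ (admissible strategy profiles). $\mu_0$ is a mean-zero probability measure on $\mathbb{R}$, $\xi_0\sim\mu_0$; $b:A\times\mathbb{R}\to\mathbb{R}$ and $f:\mathbb{R}\times A\times\mathbb{R}\to\mathbb{R}$ are given functions, and $\mathcal{J}(\alpha,z)=\mathbb{E}[f(b(\alpha,z)+\xi_0,\alpha,z)]$ for $(\alpha,z)\in A\times\mathbb{R}$ (assumed well defined). A graphon is a symmetric Borel measurable square-integrable function $w:I\times I\to\mathbb{R}$; its graphon operator is $[\mathbf{W}g]_x=\int_I w(x,y)g(y)\,dy$ on $L^2(I)$, with operator norm $\|\mathbf{W}\|$. When $\sqrt{c_z}\|\mathbf{W}\|<1$ and (i) holds, for each $\boldsymbol{\alpha}\in\mathbb{A}$ there is a unique $\mathbf{z}\in L^2(I)$ with $z_x=\int_I w(x,y)b(\alpha_y,z_y)\,dy$ for a.e. $x$; it is denoted $\mathbf{Z}\boldsymbol{\alpha}$. A player $x$ using action $\alpha\in A$ while the others use $\boldsymbol{\alpha}$ incurs cost $\mathcal{J}(\alpha,[\mathbf{Z}\boldsymbol{\alpha}]_x)$. A Nash equilibrium for the graphon game is $\hat{\boldsymbol{\alpha}}\in\mathbb{A}$ such that for a.e. $x\in I$, $\mathcal{J}(\hat\alpha_x,[\mathbf{Z}\hat{\boldsymbol{\alpha}}]_x)\le\mathcal{J}(\beta,[\mathbf{Z}\hat{\boldsymbol{\alpha}}]_x)$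 for all $\beta\in A$. *)

(* Defs.v *)
From HB Require Import structures.
From mathcomp Require Import all_boot all_order all_algebra.
From mathcomp Require Import all_classical all_reals all_analysis.

Set Implicit Arguments.
Unset Strict Implicit.
Unset Printing Implicit Defensive.
Import Order.TTheory GRing.Theory Num.Theory.
Import numFieldNormedType.Exports.
Local Open Scope classical_set_scope.
Local Open Scope ring_scope.

(* Functions on I = [0, 1] are represented by total functions on R whose values
   outside I are never used: norms are taken after restriction to I, integrals
   are over I, and "a.e." means "for Lebesgue-a.e. x in I". *)
Definition unitI {R : realType} : set R := `[0, 1]%classic.

(* Representatives of elements of the real L^2 space over D; the restriction
   f \_ D is f on D and 0 elsewhere. *)
Definition in_L2 {d : measure_display} {T : measurableType d} {R : realType}
    (mu : {measure set T -> \bar R}) (D : set T) (f : T -> R) : Prop :=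
  f \_ D \in Lfun mu 2%:E.

Definition normL2 {d : measure_display} {T : measurableType d} {R : realType}
    (mu : {measure set T -> \bar R}) (D : set T) (f : T -> R) : \bar R :=
  ('N[mu]_2%:E[EFin \o f \_ D])%E.

Section graphon.
Variable R : realType.
Local Notation leb := (@lebesgue_measure R).

Definition is_graphon (w : R -> R -> R) : Prop :=
  (forall x y, unitI x -> unitI y -> w x y = w y x) /\
  in_L2 (leb \x leb)%E (unitI `*` unitI) (fun p => w p.1 p.2).

Definition graphon_op (w : R -> R -> R) (g : R -> R) : R -> R :=
  fun x => \int[leb]_(y in unitI) (w x y * g y).

Definition graphon_norm (w : R -> R -> R) : \bar R :=
  ereal_sup [set normL2 leb unitI (graphon_op w g) | g in
    [set g | in_L2 leb unitI g /\ (normL2 leb unitI g <= 1)%E]].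

End graphon.

(* Differentiability relative to A: one-sided at the boundary points of A.
   When A is a singleton the filter is trivial, so differentiability is
   vacuous and the value of the derivative is arbitrary. *)
Section derivative_within.
Variable R : realType.
Implicit Types (A : set R) (g : R -> R) (a : R).

Definition derivable_within A g a : Prop :=
  cvg ((g x - g a) / (x - a) @[x --> within A a^']).

Definition derive_within A g a : R :=
  lim ((g x - g a) / (x - a) @[x --> within A a^']).

Definition C1_on A g : Prop :=
  (forall a, A a -> derivable_within A g a) /\
  {within A, continuous (derive_within A g)}.

End derivative_within.

Section graphon_game.
Variable R : realType.
Local Notation leb := (@lebesgue_measure R).

Section cost.
Context (d : measure_display) (Omega : measurableType d).
Variables (P : probability Omega R) (xi0 : Omega -> R).
Variables (b : R -> R -> R) (f : R -> R -> R -> R).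

Definition cost_well_defined (A : set R) : Prop :=
  forall a z, A a ->
    P.-integrable setT (fun om => (f (b a z + xi0 om) a z)%:E).

Definition cost (a z : R) : R :=
  fine 'E_P[(fun om => f (b a z + xi0 om) a z)%R].

End cost.

Definition admissible (A : set R) (alpha : R -> R) : Prop :=
  in_L2 leb unitI alpha /\ (forall x, unitI x -> A (alpha x)).

Definition solves_aggregate (w b : R -> R -> R) (alpha z : R -> R) : Prop :=
  in_L2 leb unitI z /\
  {ae leb, forall x, unitI x ->
    z x = \int[leb]_(y in unitI) (w x y * b (alpha y) (z y))}.

(* z represents Z alpha, the unique element of L^2(I) solving the aggregate
   equation; both existence and a.e.-uniqueness are part of the definition. *)
Definition is_aggregate (w b : R -> R -> R) (alpha z : R -> R) : Prop :=
  solves_aggregate w b alpha z /\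
  (forall z', solves_aggregate w b alpha z' ->
    {ae leb, forall x, unitI x -> z' x = z x}).

Definition nash_equilibrium (A : set R) (w b J : R -> R -> R)
    (alpha : R -> R) : Prop :=
  admissible A alpha /\
  exists2 z, is_aggregate w b alpha z &
    {ae leb, forall x, unitI x ->
      forall beta, A beta -> J (alpha x) (z x) <= J beta (z x)}.

End graphon_game.

(* Main.v *)
Require Import Defs.
From HB Require Import structures.
From mathcomp Require Import all_boot all_order all_algebra.
From mathcomp Require Import all_classical all_reals all_analysis.
From mathcomp Require Import measurable_realfun.
From mathcomp Require Import zify ring lra.

Set Implicit Arguments.
Unset Strict Implicit.
Unset Printing Implicit Defensive.
Import Order.TTheory GRing.Theory Num.Theory.
Import numFieldNormedType.Exports.
Local Open Scope classical_set_scope.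
Local Open Scope ring_scope.

(** In equilibrium every player answers the aggregate [z x] by the action
    [resp (z x)], where [resp t] minimizes the cost [J a t] over [a] in [A].
    Since the aggregate of [resp \o z] must be [z] itself, the game reduces to
    the Hammerstein equation

      z x = \int_(y in [0, 1]) w x y * beta (z y),   beta t := b (resp t) t.

    Given a solution [z] in L^2, the profile [resp \o z] is an equilibrium: [z]
    solves its aggregate equation by construction, it is the only solution
    because [sqrt c_z * ||W|| < 1] makes that equation a contraction in the
    aggregate ([contraction_unique]), and optimality holds at every [x].

    Strong convexity makes [resp] well defined, and comparing the first-order
    conditions at two aggregates makes it Lipschitz with constant
    [ell_J / ell_c] ([lipschitz_best_response]). Hence [beta] is Lipschitz and
    bounded by [c_0]. It need not be a contraction, so a solution of the
    Hammerstein equation comes from compactness, as in the theorem of Schauder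
    ([hammerstein_solution]). On the subdivision of [0, 1] into [n + 1] cells one
    looks for a step function [v_n], with coefficients [c], whose value on each
    cell is the mean there of [beta (W v_n)]. This is a fixed point problem for a
    Lipschitz map of the cube [-c_0, c_0]^(n + 1), solved up to an error
    [1 / (n + 1)] by [lipschitz_approx_fixpoint]. The [v_n] are uniformly bounded,
    so along a subsequence their integrals over each of the countably many cells
    converge, and then so do their integrals against every integrable function,
    step functions being dense in L^1. As [w x] is integrable for almost every
    [x], [W v_n] converges almost everywhere to some [z], and [beta (W v_n)] to
    [beta z] by continuity. Finally [v_n] and [beta (W v_n)] have the same weak limit
    because they have almost the same means on fine cells, so [z = W (beta z)] by
    dominated convergence.

    The approximate fixed points rest on a discrete Poincare-Miranda theorem
    ([grid_poincare_miranda]): if [n] two-valued labels of the points of an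
    [n]-dimensional lattice box are such that the [j]-th one is 0 on the lower
    and 1 on the upper [j]-th face, then all the labels change inside some unit
    cube. It is proved with the cup product of the coboundaries of the labels,
    modulo 2: the sum of that product over all unit cubes is 1 by induction on
    the dimension, the discrete Stokes formula reducing it to the faces. *)

(** * A mod 2 degree on a box of lattice points *)

Section cubical_cochains.
Variable n : nat.
Local Notation point := {ffun 'I_n -> nat}.
Implicit Types (v : point) (S : {set 'I_n}) (g : point -> 'F_2).

Definition put v (j : 'I_n) (k : nat) : point :=
  [ffun i => if i == j then k else v i].

Definition step v (j : 'I_n) : point := put v j (v j).+1.

Lemma putE v j k i : put v j k i = if i == j then k else v i.
Proof. by rewrite ffunE. Qed.

Lemma put_put v j k l : put (put v j k) j l = put v j l.
Proof. by apply/ffunP => i; rewrite !putE; case: eqP. Qed.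

Lemma putC v i j k l : i != j -> put (put v i k) j l = put (put v j l) i k.
Proof.
move=> ij; apply/ffunP => h; rewrite !putE.
by case: (eqVneq h j) => // ->; rewrite eq_sym (negbTE ij).
Qed.

Lemma step_put v j k : step (put v j k) j = put v j k.+1.
Proof. by rewrite /step put_put putE eqxx. Qed.

Lemma stepC v i j : step (step v i) j = step (step v j) i.
Proof.
case: (eqVneq i j) => [->//|ij].
by rewrite /step putC// !putE (negbTE ij) eq_sym (negbTE ij).
Qed.

(** The cubical cup product of the coboundaries of the functions [gs],
    evaluated on the cube with lowest vertex [v] and edge directions [S]: a sum
    over the monotone edge paths from [v] to the opposite vertex, that is over
    the simplices of the Kuhn triangulation. Coefficients in ['F_2] dispense
    with the signs of the permutations. *)
Fixpoint cup (gs : seq (point -> 'F_2)) v S : 'F_2 :=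
  if gs is g :: gs' then
    \sum_(j in S) (g (step v j) - g v) * cup gs' (step v j) (S :\ j)
  else 1.

Lemma addF2K (x : 'F_2) : x + x = 0.
Proof. by rewrite -mulr2n mulrn_pchar// pchar_Fp. Qed.

Lemma oppF2 (x : 'F_2) : - x = x.
Proof. by apply/eqP; rewrite eq_sym -subr_eq0 opprK addF2K. Qed.

Lemma sum_sym_offdiag S (h : 'I_n -> 'I_n -> 'F_2) :
  (forall j k, h j k = h k j) -> \sum_(j in S) \sum_(k in S :\ j) h j k = 0.
Proof.
move=> hC.
have -> : \sum_(j in S) \sum_(k in S :\ j) h j k =
  \sum_(j in S) \sum_(k in S | (j < k)%N) h j k +
  \sum_(j in S) \sum_(k in S | (k < j)%N) h j k.
  rewrite -big_split; apply: eq_bigr => j jS /=.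
  rewrite (bigID (fun k : 'I_n => (j < k)%N)) /=; congr (_ + _);
  apply: eq_bigl => k; rewrite !inE -val_eqE /=; case: (k \in S);
    rewrite ?andbF ?andbT//=; lia.
rewrite [X in _ + X](exchange_big_dep (mem S)) /=; last by move=> i j _ /andP[].
rewrite -[RHS](addF2K (\sum_(j in S) \sum_(k in S | (j < k)%N) h j k)).
congr (_ + _); apply: eq_bigr => j jS; apply: eq_big => k; first by rewrite jS.
by move=> _; rewrite hC.
Qed.

(** A cup product of coboundaries is a cocycle: its sum over the facets of a
    cube vanishes. In the induction, the terms that depend symmetrically on two
    successive directions cancel modulo 2. *)
Lemma cup_closed gs v S : #|S| = (size gs).+1 ->
  \sum_(j in S) (cup gs (step v j) (S :\ j) + cup gs v (S :\ j)) = 0.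
Proof.
elim: gs v S => [|g gs IH] v S /= Scard.
  by apply: big1 => j _; rewrite addF2K.
have cardD1 j : j \in S -> #|S :\ j| = (size gs).+1.
  by move=> jS; have := cardsD1 j S; rewrite Scard jS add1n => -[].
have setDC j k : S :\ j :\ k = S :\ k :\ j by rewrite !finset.setDDl finset.setUC.
(* After expanding one more coboundary, [a] is symmetric in the two directions
   and the other terms regroup into instances of the induction hypothesis. *)
pose a j k := g (step (step v j) k) * cup gs (step (step v j) k) (S :\ j :\ k).
pose c j k := g v * (cup gs (step v k) (S :\ j :\ k)).
have e j k : (g (step (step v j) k) - g (step v j)) *
    cup gs (step (step v j) k) (S :\ j :\ k) +
    (g (step v k) - g v) * cup gs (step v k) (S :\ j :\ k) =
  a j k + c j k + (g (step v j) * cup gs (step (step v j) k) (S :\ j :\ k)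
   + g (step v k) * cup gs (step v k) (S :\ j :\ k)).
  by rewrite !oppF2 /a /c; ring.
under eq_bigr => j _.
  rewrite -big_split /=; under eq_bigr => k _ do rewrite e.
  rewrite !big_split /=; over.
rewrite !big_split /= sum_sym_offdiag; last first.
  by move=> j k; rewrite /a stepC setDC.
rewrite add0r.
have swap (h : 'I_n -> 'I_n -> 'F_2) : \sum_(j in S) \sum_(k in S :\ j) h j k =
    \sum_(j in S) \sum_(k in S :\ j) h k j.
  rewrite (exchange_big_dep (mem S)) /=; last by move=> i j _ /finset.setD1P[].
  apply: eq_bigr => j jS; apply: eq_bigl => k; rewrite !inE jS andbT andbC eq_sym//.
rewrite [X in _ + (_ + X)]swap -big_split /= .
have -> : \sum_(j in S) (\sum_(k in S :\ j) g (step v j) * cup gs (step (step v j) k) (S :\ j :\ k) +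
   \sum_(k in S :\ j) g (step v j) * cup gs (step v j) (S :\ k :\ j)) = 0.
  apply: big1 => j jS; rewrite -!mulr_sumr -mulrDr -big_split /=.
  under eq_bigr => k _ do rewrite (setDC k j).
  by rewrite IH ?mulr0// cardD1.
rewrite addr0 swap /c.
under eq_bigr => j jS do rewrite -mulr_sumr.
rewrite -mulr_sumr.
have -> : \sum_(i in S) \sum_(i0 in S :\ i) cup gs (step v i) (S :\ i0 :\ i) =
   \sum_(i in S) \sum_(i0 in S :\ i) cup gs (step (step v i) i0) (S :\ i :\ i0).
  apply/eqP; rewrite -subr_eq0 -sumrB big1// => j jS.
  rewrite -sumrB.
  under eq_bigr => k _ do rewrite (setDC k j).
  have := IH (step v j) (S :\ j) (cardD1 j jS).
  by under eq_bigr do rewrite addrC; under [in X in _ -> X]eq_bigr do rewrite oppF2.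
by rewrite sum_sym_offdiag ?mulr0// => j k; rewrite stepC setDC.
Qed.

(** As [cup gs] is closed, the product with one more coboundary [dg] is the
    coboundary of [g * cup gs]. Summed over a box, only the boundary of the box
    will remain. *)
Lemma cup_stokes g gs v S : #|S| = (size gs).+1 ->
  cup (g :: gs) v S =
  \sum_(j in S) (g (step v j) * cup gs (step v j) (S :\ j) + g v * cup gs v (S :\ j)).
Proof.
move=> Scard /=; apply/eqP; rewrite -subr_eq0 -sumrB.
rewrite (eq_bigr (fun j => - (g v *
   (cup gs (step v j) (S :\ j) + cup gs v (S :\ j))))); last by move=> j _; ring.
by rewrite sumrN -mulr_sumr cup_closed// mulr0 oppr0.
Qed.

End cubical_cochains.

Section box_sums.
Variables n N : nat.
Local Notation point := {ffun 'I_n -> nat}.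
Implicit Types (v : point) (js : seq 'I_n) (g : point -> 'F_2).

(** The recursion over a list of directions makes it possible to sum over the
    directions in any order, see [boxsum_rem]; the coordinates of [v] outside
    the list stay fixed. *)
Fixpoint boxsum js g v : 'F_2 :=
  if js is j :: js' then \sum_(i < N) boxsum js' g (put v j i) else g v.

Lemma eq_boxsum js g h v : g =1 h -> boxsum js g v = boxsum js h v.
Proof. by move=> gh; elim: js v => //= j js IH v; under eq_bigr do rewrite IH. Qed.

Lemma boxsum_sum (J : finType) (A : pred J) js (G : J -> point -> 'F_2) v :
  boxsum js (fun u => \sum_(k | A k) G k u) v = \sum_(k | A k) boxsum js (G k) v.
Proof.
elim: js v => //= j js IH v; rewrite exchange_big /=.
by under eq_bigr do rewrite IH.
Qed.

Lemma boxsum0 js v : boxsum js (fun=> 0) v = 0.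
Proof. by elim: js v => //= j js IH v; rewrite big1. Qed.

Lemma boxsum_put js g v j k : j \notin js ->
  boxsum js (fun u => g (put u j k)) v = boxsum js g (put v j k).
Proof.
elim: js v => //= i js IH v; rewrite inE negb_or => /andP[ji jjs].
by under eq_bigr => l _ do rewrite IH// (putC _ _ _ (j:=j)) 1?eq_sym//.
Qed.

(** Summing along one chosen direction first is what lets the facet sums of
    [cup_stokes] telescope in that direction. *)
Lemma boxsum_rem js g v j : uniq js -> j \in js ->
  boxsum js g v = boxsum (rem j js) (fun u => \sum_(i < N) g (put u j i)) v.
Proof.
elim: js v => //= k js IH v /andP[kjs ujs]; rewrite inE eq_sym.
case: eqVneq => [<-|jk] /= jjs.
  rewrite (@boxsum_sum 'I_N predT js (fun i u => g (put u k i))).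
  by apply: eq_bigr => i _; rewrite boxsum_put.
by under eq_bigr => i _ do rewrite IH//.
Qed.

Lemma boxsum_neq0 js g v : boxsum js g v != 0 ->
  exists u : point, [/\ forall i, i \in js -> (u i < N)%N,
    forall i, i \notin js -> u i = v i & g u != 0].
Proof.
elim: js v => [|j js IH] v /=; first by exists v; split.
move=> s0.
have [l] : exists l : 'I_N, boxsum js g (put v j l) != 0.
  apply: contrapT => /forallNP s1; case/eqP: s0; apply: big1 => i _.
  by have /negP := s1 i; rewrite negbK => /eqP.
move=> /IH[u [u1 u2 u3]]; exists u; split => // i; rewrite inE; last first.
  by rewrite negb_or => /andP[ij /u2 ->]; rewrite putE (negbTE ij).
have [/u1//|ijs] := boolP (i \in js); rewrite orbF => /eqP ij.
by rewrite u2// putE ij eqxx.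
Qed.

Variable F : 'I_n -> point -> 'F_2.
Hypothesis F0 : forall j v, v j = 0%N -> F j v = 0.
Hypothesis FN : forall j v, v j = N -> F j v = 1.

(** On a face orthogonal to the direction [k] the label [F k] is constant, so
    its coboundary kills the product. *)
Lemma cup_face js v (T : {set 'I_n}) k : k \in js -> k \notin T ->
  v k = 0%N \/ v k = N -> cup (map F js) v T = 0.
Proof.
elim: js v T => //= j js IH v T; rewrite inE => kjs kT vk.
apply: big1 => i iT.
have ki : k != i by apply: contraNneq kT => ->.
have vik : step v i k = v k by rewrite putE (negbTE ki).
have [kj|kj] := eqVneq k j.
  by rewrite -kj; case: vk => vk; [rewrite !F0|rewrite !FN]; rewrite ?vik// subrr mul0r.
rewrite IH ?mulr0//; first by move: kjs; rewrite (negbTE kj).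
- by rewrite !inE (negbTE kT) andbF.
- by rewrite vik.
Qed.

(** The labels have degree 1 on the box. By Stokes the sum reduces to the boundary of
    the box; every face but the upper one in the first direction [j] contributes
    0, by [cup_face] or because [F j] vanishes on the lower face. On the upper
    face [F j] is 1 and what remains is the same sum in one dimension less. *)
Lemma boxsum_cup js v : uniq js ->
  boxsum js (fun u => cup (map F js) u [set j in js]) v = 1.
Proof.
elim: js v => // j js IH v ujs; have /andP[jjs ujs'] := ujs.
set S := [set i in j :: js].
have Scard : #|S| = (size (map F js)).+1.
  by rewrite size_map cardsE; apply/card_uniqP.
rewrite (eq_boxsum _ _ (fun u => @cup_stokes _ (F j) _ u _ Scard)).
rewrite boxsum_sum.
(* The value on a facet orthogonal to [k] of the cochain whose coboundary is
   being summed. *)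
pose Q k u := F j u * cup (map F js) u (S :\ k).
have tele k u : \sum_(i < N) (Q k (step (put u k i) k) + Q k (put u k i)) =
    Q k (put u k N) + Q k (put u k 0%N).
  under eq_bigr do rewrite step_put -[X in _ + X]oppF2.
  by rewrite -(big_mkord xpredT (fun i => Q k (put u k i.+1) - Q k (put u k i)))
    telescope_sumr// oppF2.
have face k : k \in S -> boxsum (j :: js) (fun u => Q k (step u k) + Q k u) v =
    boxsum (rem k (j :: js)) (fun u => Q k (put u k N) + Q k (put u k 0%N)) v.
  move=> kS; rewrite (@boxsum_rem _ _ _ k)//; last by move: kS; rewrite inE.
  exact: eq_boxsum.
rewrite (eq_bigr _ face) (bigD1 j) /=; last by rewrite !inE eqxx.
rewrite eqxx big1 ?addr0; last first.
  move=> k /andP[]; rewrite !inE => /orP[->//|kjs] kj.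
  rewrite (@eq_boxsum _ _ (fun=> 0)) ?boxsum0// => u.
  rewrite /Q !(@cup_face _ _ _ k) ?mulr0 ?addr0 ?finset.setD11 ?putE ?eqxx//; tauto.
have -> : boxsum js (fun u => Q j (put u j N) + Q j (put u j 0%N)) v =
    boxsum js (fun u => cup (map F js) u [set i in js]) (put v j N).
  rewrite -boxsum_put//; apply: eq_boxsum => u.
  rewrite /Q FN ?putE ?eqxx// F0 ?putE ?eqxx// mul0r addr0 mul1r; congr cup.
  apply/setP => i; rewrite !inE; case: eqVneq => //= ->.
  exact/esym/negbTE.
exact: IH.
Qed.

End box_sums.

Section poincare_miranda.
Variable n : nat.
Local Notation point := {ffun 'I_n -> nat}.

(** A nonzero term of the product is a path in the cube along which each
    function changes on the corresponding edge. *)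
Lemma cup_neq0 (gs : seq (point -> 'F_2)) (v : point) (S : {set 'I_n}) :
  cup gs v S != 0 -> forall i, (i < size gs)%N -> exists p q : point,
  [/\ forall k, (v k <= p k <= v k + (k \in S))%N,
      forall k, (v k <= q k <= v k + (k \in S))%N &
      nth (fun=> 0) gs i p != nth (fun=> 0) gs i q].
Proof.
elim: gs v S => // g gs IH v S /= s0.
have [j] : exists j, (j \in S) && ((g (step v j) - g v) * cup gs (step v j) (S :\ j) != 0).
  apply: contrapT => /forallNP s1; case/eqP: s0; apply: big1 => j jS.
  by apply/eqP/negPn/negP => h; apply: (s1 j); rewrite jS.
rewrite mulf_eq0 negb_or subr_eq0 => /and3P[jS g0 c0].
have [jv jv'] : step v j j = (v j).+1 /\ forall k, k != j -> step v j k = v k.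
  by split=> [|k /negbTE kj]; rewrite putE ?eqxx ?kj.
case=> [_|i]; last first.
  rewrite ltnS => /(IH _ _ c0)[p [q [hp hq pq]]].
  exists p, q; split => // k; [move: (hp k)|move: (hq k)];
  rewrite !inE; case: (eqVneq k j) => [->|kj] /=;
  rewrite ?jv ?(jv' _ kj) ?jS//= ; lia.
exists (step v j), v; split => // k; last by lia.
by case: (eqVneq k j) => [->|kj]; rewrite ?jv ?(jv' _ kj) ?jS; lia.
Qed.

Lemma grid_poincare_miranda (N : nat) (F : 'I_n -> point -> bool) :
  (forall j (v : point), v j = 0%N -> F j v = false) ->
  (forall j (v : point), v j = N -> F j v = true) ->
  exists v : point, (forall j, (v j < N)%N) /\ forall j, exists p q : point,
    [/\ forall k, (v k <= p k <= (v k).+1)%N,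
        forall k, (v k <= q k <= (v k).+1)%N, F j p & ~~ F j q].
Proof.
move=> F0 FN; pose G j v : 'F_2 := (F j v)%:R.
have G0 j (v : point) : v j = 0%N -> G j v = 0 by rewrite /G => /F0 ->.
have GN j (v : point) : v j = N -> G j v = 1 by rewrite /G => /FN ->.
have := boxsum_cup G0 GN [ffun=> 0%N] (enum_uniq 'I_n).
move=> /eqP; rewrite eq_sym => /eqP s1.
have : boxsum N (enum 'I_n) (fun u => cup (map G (enum 'I_n)) u [set j in enum 'I_n])
  [ffun=> 0%N] != 0 by rewrite -s1.
move=> /boxsum_neq0[v [vN _ c0]]; exists v; split => [j|j].
  by apply: vN; rewrite mem_enum.
have jn : (j < size (map G (enum 'I_n)))%N by rewrite size_map size_enum_ord.
have [p [q [hp hq]]] := cup_neq0 c0 jn.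
rewrite (nth_map j) ?size_enum_ord// nth_ord_enum => Gpq.
have le1 u : (forall k, (v k <= u k <= v k + (k \in [set i in enum 'I_n]))%N) ->
    forall k, (v k <= u k <= (v k).+1)%N.
  by move=> h k; move: (h k); rewrite inE mem_enum inE addn1.
move/le1 : hp => hp; move/le1 : hq => hq.
case Fp : (F j p); case Fq : (F j q); move: Gpq; rewrite /G ?Fp ?Fq ?eqxx// => _.
- by exists p, q; rewrite Fp Fq; split.
- by exists q, p; rewrite Fp Fq; split.
Qed.

End poincare_miranda.

(** * Approximate fixed points of Lipschitz maps of a cube *)

Section brouwer.
Variables (R : realType) (n : nat).
Implicit Types (c : 'I_n -> R) (F : ('I_n -> R) -> 'I_n -> R).

(** Label a lattice point of the cube by 1 in direction [j] when [F] does not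
    increase the [j]-th coordinate there. In a unit cell where the [j]-th label
    changes, [F c j - c j] takes both signs, up to equality, and the Lipschitz
    bound makes it small on the whole cell. *)
Lemma lipschitz_approx_fixpoint F (M K : R) : 0 < M -> 0 <= K ->
  (forall c i, (forall j, `|c j| <= M) -> `|F c i| <= M) ->
  (forall c c' (delta : R) i, (forall j, `|c j| <= M) -> (forall j, `|c' j| <= M) ->
    (forall j, `|c j - c' j| <= delta) -> `|F c i - F c' i| <= K * delta) ->
  forall eps : R, 0 < eps ->
  exists c, (forall i, `|c i| <= M) /\ forall i, `|F c i - c i| <= eps.
Proof.
move=> M0 K0 FM Flip eps eps0.
(* Across a cell of mesh [h], [F c i] moves by at most [K * h] and [c i] by at
   most [h]. *)
pose N := (Num.truncn (2 * M * (K + 1) / eps)).+1.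
have N0 : 0 < N%:R :> R by rewrite ltr0n.
pose h := 2 * M / N%:R.
have h0 : 0 < h by rewrite divr_gt0// mulr_gt0.
have hN : (K + 1) * h <= eps.
  rewrite /h mulrA ler_pdivrMr// [eps * _]mulrC -ler_pdivrMr//.
  by rewrite [_ * (2 * M)]mulrC ltW// truncnS_gt.
pose pt (v : {ffun 'I_n -> nat}) (i : 'I_n) : R := - M + h * (v i)%:R.
have hNM : h * N%:R = 2 * M by rewrite /h divfK// gt_eqF.
have ptM (v : {ffun 'I_n -> nat}) i : (v i <= N)%N -> `|pt v i| <= M.
  move=> viN; rewrite ler_norml /pt lerDl mulr_ge0 ?(ltW h0)//=.
  have : h * (v i)%:R <= 2 * M by rewrite -hNM ler_pM2l// ler_nat.
  by move=> ?; lra.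
(* The comparisons with 0 and [N] force the boundary values, which agree with
   the comparison of [F] and [pt] up to equality cases. *)
pose lab (j : 'I_n) (v : {ffun 'I_n -> nat}) :=
  (v j == N) || (0 < v j)%N && (F (pt v) j <= pt v j).
have lab0 j (v : {ffun 'I_n -> nat}) : v j = 0%N -> lab j v = false by rewrite /lab => ->.
have labN j (v : {ffun 'I_n -> nat}) : v j = N -> lab j v = true.
  by rewrite /lab => ->; rewrite eqxx.
have [v [vN hv]] := grid_poincare_miranda lab0 labN.
exists (pt v); split => [i|i]; first by apply: ptM; exact: ltnW.
have [p [q [hp hq lp lq]]] := hv i.
have le_pt (u : {ffun 'I_n -> nat}) : (forall k, (v k <= u k <= (v k).+1)%N) ->
    (forall j, `|pt u j| <= M) /\ forall j, 0 <= pt u j - pt v j <= h.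
  move=> hu; split => j.
    by apply: ptM; have /andP[_] := hu j; move/leq_trans; apply; exact: vN.
  have -> : pt u j - pt v j = h * ((u j)%:R - (v j)%:R) by rewrite /pt; ring.
  have /andP[u1 u2] := hu j.
  rewrite mulr_ge0 ?(ltW h0)//= ?subr_ge0 ?ler_nat// -[leRHS]mulr1 ler_pM2l//.
  by rewrite lerBlDl natr1 ler_nat.
have [pM hpv] := le_pt p hp; have [qM hqv] := le_pt q hq.
have vM j : `|pt v j| <= M by apply: ptM; exact: ltnW.
have close (u : {ffun 'I_n -> nat}) : (forall j, `|pt u j| <= M) ->
    (forall j, 0 <= pt u j - pt v j <= h) ->
    `|F (pt u) i - F (pt v) i| <= K * h.
  move=> uM huv; apply: Flip => // j.
  by have /andP[? ?] := huv j; rewrite ger0_norm.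
have := close p pM hpv; have := close q qM hqv; rewrite !ler_norml.
have /andP[? ?] := hpv i; have /andP[? ?] := hqv i.
have Fp : F (pt p) i <= pt p i.
  move: lp; rewrite /lab => /orP[/eqP piN|/andP[]//].
  have := FM _ i pM; rewrite ler_norml => /andP[_ /le_trans]; apply.
  by rewrite /pt piN hNM; lra.
have Fq : pt q i <= F (pt q) i.
  move: lq; rewrite /lab negb_or negb_and -leqNgt leqn0 => /andP[_ /orP[/eqP qi0|]].
    have := FM _ i qM; rewrite ler_norml => /andP[+ _]; apply: le_trans.
    by rewrite /pt qi0; lra.
  by rewrite -ltNge => /ltW.
move=> /andP[? ?] /andP[? ?].
rewrite mulrDl mul1r in hN.
by apply/andP; split; lra.
Qed.

End brouwer.

(** * Strong convexity and Lipschitz best responses *)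

Section strongly_convex.
Variables (R : realType) (A : set R) (g : R -> R) (l : R).
Hypothesis l0 : 0 < l.
Hypothesis Acvx : forall x y (t : R), A x -> A y -> 0 <= t -> t <= 1 -> A (t * x + (1 - t) * y).
Hypothesis gder : forall a, A a -> derivable_within A g a.
Hypothesis gcvx : forall a a' (t : R), A a -> A a' -> 0 <= t -> t <= 1 ->
  g (t * a + (1 - t) * a') <=
    t * g a + (1 - t) * g a' - l / 2 * t * (1 - t) * `|a - a'| ^+ 2.

Let seg a a' n : R := harmonic n * a' + (1 - harmonic n) * a.

Let harmonic_le1 n : harmonic n <= 1 :> R.
Proof. by rewrite /= invf_le1 ?ltr0n// ler1n. Qed.

Let A_seg a a' n : A a -> A a' -> A (seg a a' n).
Proof. by move=> Aa Aa'; apply: Acvx => //; exact: harmonic_ge0. Qed.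

(** The derivative within [A] sees the segment towards any other point of [A],
    by convexity. The tangent inequality and the first-order condition come from
    this limit. *)
Lemma cvg_directional_slope a a' : A a -> A a' -> a != a' ->
  (g (seg a a' n) - g a) / harmonic n @[n --> \oo] -->
    derive_within A g a * (a' - a).
Proof.
move=> Aa Aa' aa'.
have seg_cvg : seg a a' n @[n --> \oo] --> a.
  suff : seg a a' n @[n --> \oo] --> 0 * a' + (1 - 0) * a.
    by rewrite mul0r add0r subr0 mul1r.
  apply: cvgD; first exact: (cvgMr_tmp cvg_harmonic).
  apply: cvgMr_tmp; apply: cvgB; [exact: cvg_cst|exact: cvg_harmonic].
have seg_within : seg a a' n @[n --> \oo] --> within A a^'.
  move=> B nB; have nB' : nbhs a (fun x => x != a -> A x -> B x) := nB.
  have : \forall n \near \oo, seg a a' n != a -> A (seg a a' n) -> B (seg a a' n).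
    exact: seg_cvg nB'.
  apply: filterS => n; apply; last exact: A_seg.
  rewrite -subr_eq0 /seg.
  have -> : harmonic n * a' + (1 - harmonic n) * a - a = harmonic n * (a' - a) by ring.
  apply: mulf_neq0; first by rewrite gt_eqF// harmonic_gt0.
  by rewrite subr_eq0 eq_sym.
have slope_cvg := cvg_comp _ _ seg_within (gder Aa).
apply: cvg_trans (cvgMr_tmp slope_cvg).
apply: near_eq_cvg; apply: nearW => n /=.
rewrite /seg.
have -> : harmonic n * a' + (1 - harmonic n) * a - a = harmonic n * (a' - a) by ring.
have h0 := gt_eqF (harmonic_gt0 (R:=R) n).
have a0 : a' - a != 0 by rewrite subr_eq0 eq_sym.
by rewrite invfM -!mulrA mulVf// mulr1.
Qed.

(** Rearranging strong convexity bounds the slopes towards [a']; the bound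
    passes to the limit. *)
Lemma strongly_convex_tangent a a' : A a -> A a' ->
  g a + derive_within A g a * (a' - a) + l / 2 * (a' - a) ^+ 2 <= g a'.
Proof.
move=> Aa Aa'; have [<-|aa'] := eqVneq a a'.
  by rewrite subrr expr0n/= !mulr0 !addr0.
pose u (n : nat) : R := g a' - g a - l / 2 * (1 - harmonic n) * (a' - a) ^+ 2.
have cu : u @ \oo --> g a' - g a - l / 2 * (1 - 0) * (a' - a) ^+ 2.
  apply: cvgB; first exact: cvg_cst.
  apply: cvgMr_tmp; apply: cvgMl_tmp; apply: cvgB; [exact: cvg_cst|exact: cvg_harmonic].
have : derive_within A g a * (a' - a) <= g a' - g a - l / 2 * (1 - 0) * (a' - a) ^+ 2.
  apply: ler_cvg_to (cvg_directional_slope Aa Aa' aa') cu _.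
  apply: nearW => n; rewrite ler_pdivrMr ?harmonic_gt0//.
  have := gcvx Aa' Aa (harmonic_ge0 n) (harmonic_le1 n).
  rewrite real_normK ?num_real// /u /seg => h.
  by nra.
by move=> h; lra.
Qed.

Lemma first_order_optimality a a' : A a -> A a' ->
  (forall x, A x -> g a <= g x) -> 0 <= derive_within A g a * (a' - a).
Proof.
move=> Aa Aa' amin; have [<-|aa'] := eqVneq a a'; first by rewrite subrr mulr0.
apply: (cvgr_to_ge (cvg_directional_slope Aa Aa' aa')).
apply: nearW => n; rewrite divr_ge0 ?harmonic_ge0// subr_ge0 amin//.
exact: A_seg.
Qed.

Lemma derivable_within_continuous_within : {within A, continuous g}.
Proof.
apply/subspace_continuousP => a Aa.
apply/cvgrPdist_le => e e0.
have /cvgrPdist_le/(_ 1 ltr01) := gder Aa.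
set D := lim _ => nD.
pose r := e / (`|D| + 1).
have D1 : 0 < `|D| + 1 by rewrite ltr_pwDr.
have r0 : 0 < r by rewrite divr_gt0.
have nr : \forall x \near a, `|a - x| < r by apply: nbhsx_ballx.
have {nD}nD : \forall x \near a, x != a -> A x -> `|D - (g x - g a) / (x - a)| <= 1.
  exact: nD.
suff : \forall x \near a, A x -> `|g a - g x| <= e by [].
near=> x => Ax.
have [->|xa] := eqVneq x a; first by rewrite subrr normr0 ltW.
have : `|D - (g x - g a) / (x - a)| <= 1.
  by move: xa Ax; near: x.
have /ltW : `|a - x| < r by near: x.
rewrite distrC => ar.
move=> nDx.
have xa0 : x - a != 0 by rewrite subr_eq0.
have : `|(g x - g a) / (x - a)| <= `|D| + 1.
  rewrite distrC in nDx; rewrite -[X in `|X|](subrK D) addrC.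
  by rewrite (le_trans (ler_normD _ _))// lerD2l.
rewrite normrM normfV ler_pdivrMr ?normr_gt0// distrC => /le_trans; apply.
by rewrite mulrC -ler_pdivlMr.
Unshelve. all: by end_near.
Qed.

(** By the tangent inequality at [a0], points at distance more than
    [2 * `|g' a0| / l] from [a0] cannot do better than [a0], which leaves a
    compact set to minimize on. *)
Lemma strongly_convex_minimum : closed A -> A !=set0 ->
  exists2 a, A a & forall x, A x -> g a <= g x.
Proof.
move=> Acl [a0 Aa0].
pose D := derive_within A g a0.
pose r := 2 * `|D| / l.
have r0 : 0 <= r by rewrite divr_ge0 ?mulr_ge0// ltW.
pose K := A `&` `[a0 - r, a0 + r].
have Kc : compact K.
  by rewrite /K setIC; apply: compact_closedI => //; exact: segment_compact.
have Ka0 : K a0 by split => //=; rewrite in_itv/= lerBlDr !lerDl r0.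
have [|a /set_mem Ka amin] := compact_EVT_min (f := g) (ex_intro _ a0 Ka0) Kc.
  apply: continuous_subspaceW derivable_within_continuous_within.
  by move=> x [].
exists a => [|x Ax]; first by case: Ka.
have [Kx|nKx] := pselect (K x); first by apply: amin; exact: mem_set.
have : g a <= g a0 by apply: amin; exact: mem_set.
move=> /le_trans; apply.
apply: le_trans (strongly_convex_tangent Aa0 Ax); rewrite -addrA lerDl -/D.
have rx : r <= `|x - a0|.
  rewrite leNgt; apply/negP => rx; apply: nKx; split => //=.
  by rewrite in_itv/= -ler_distl ltW.
have : - (`|D| * `|x - a0|) <= D * (x - a0).
  by have := ler_norm (- (D * (x - a0))); rewrite normrN normrM; lra.
have : l * r = 2 * `|D| by rewrite /r mulrC divfK// gt_eqF.
rewrite -[(x - a0) ^+ 2]real_normK ?num_real//.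
have := normr_ge0 D; have := normr_ge0 (x - a0).
move: rx; set n := `|x - a0|; set d := `|D|; set c := _ * (_ - _) => rx n0 d0 lr dc.
have : l * r * n <= l * n * n by rewrite ler_wpM2r// ler_pM2l.
by move=> ?; nra.
Qed.

End strongly_convex.

(** The two tangent inequalities of [J ^~ z] between [a] and [a'] give the
    strong monotonicity of its derivative. The first-order conditions at both
    minimizers leave, as an upper bound, only the change at [a'] of the
    derivative from [z] to [z']. *)
Lemma argmin_lipschitz (R : realType) (A : set R) (J : R -> R -> R) (l lJ : R) :
  0 < l -> 0 <= lJ ->
  (forall x y (t : R), A x -> A y -> 0 <= t -> t <= 1 -> A (t * x + (1 - t) * y)) ->
  (forall z a, A a -> derivable_within A (J ^~ z) a) ->
  (forall a a' z (t : R), A a -> A a' -> 0 <= t -> t <= 1 ->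
     J (t * a + (1 - t) * a') z <=
     t * J a z + (1 - t) * J a' z - l / 2 * t * (1 - t) * `|a - a'| ^+ 2) ->
  (forall a z z', A a ->
    `|derive_within A (J ^~ z') a - derive_within A (J ^~ z) a| <= lJ * `|z' - z|) ->
  forall a a' z z', A a -> A a' ->
  (forall x, A x -> J a z <= J x z) -> (forall x, A x -> J a' z' <= J x z') ->
  `|a - a'| <= lJ / l * `|z - z'|.
Proof.
move=> l0 lJ0 Acvx Jder Jcvx Jlip a a' z z' Aa Aa' amin amin'.
have cvx y b b' t := Jcvx b b' y t.
have t1 := strongly_convex_tangent Acvx (Jder z) (cvx z) Aa Aa'.
have t2 := strongly_convex_tangent Acvx (Jder z) (cvx z) Aa' Aa.
have o1 := first_order_optimality Acvx (Jder z) Aa Aa' amin.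
have o2 := first_order_optimality Acvx (Jder z') Aa' Aa amin'.
have lip := Jlip a' z' z Aa'.
have [->|aa'] := eqVneq a a'.
  by rewrite subrr normr0 mulr_ge0// divr_ge0// ltW.
have n0 : 0 < `|a - a'| by rewrite normr_gt0 subr_eq0.
rewrite mulrAC ler_pdivlMr// -(ler_pM2r n0).
move: t1 t2 o1 o2 lip.
set d := derive_within _ _ a; set d1 := derive_within _ (J ^~ z) a'.
set d2 := derive_within _ (J ^~ z') a' => t1 t2 o1 o2 lip.
have e : `|a - a'| * `|a - a'| = (a - a') ^+ 2 by rewrite -expr2 real_normK ?num_real.
have k : (d1 - d2) * (a' - a) <= `|d1 - d2| * `|a - a'|.
  by rewrite -[`|a - a'|]normrN opprB -normrM ler_norm.
rewrite mulrAC e.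
have : `|d1 - d2| * `|a - a'| <= lJ * `|z - z'| * `|a - a'| by rewrite ler_pM2r.
by move=> ?; nra.
Qed.

Lemma convex_set_real (R : realType) (A : set R) :
  convex_set (A : set R^o) ->
  forall x y t : R, A x -> A y -> 0 <= t -> t <= 1 -> A (t * x + (1 - t) * y).
Proof.
move=> cA x y t Ax Ay t0 t1.
exact: set_mem (cA x y (Itv01 t0 t1) (mem_set Ax) (mem_set Ay)).
Qed.

Section best_response.
Variables (R : realType) (A : set R) (J : R -> R -> R) (l lJ : R).
Hypothesis l0 : 0 < l.
Hypothesis lJ0 : 0 <= lJ.
Hypothesis A0 : A !=set0.
Hypothesis Acl : closed A.
Hypothesis Acvx : forall x y (t : R), A x -> A y -> 0 <= t -> t <= 1 -> A (t * x + (1 - t) * y).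
Hypothesis Jder : forall z a, A a -> derivable_within A (J ^~ z) a.
Hypothesis Jcvx : forall a a' z (t : R), A a -> A a' -> 0 <= t -> t <= 1 ->
  J (t * a + (1 - t) * a') z <=
    t * J a z + (1 - t) * J a' z - l / 2 * t * (1 - t) * `|a - a'| ^+ 2.
Hypothesis Jlip : forall a z z', A a ->
  `|derive_within A (J ^~ z') a - derive_within A (J ^~ z) a| <= lJ * `|z' - z|.

Lemma lipschitz_best_response : exists resp : R -> R,
  [/\ forall z, A (resp z), forall z a, A a -> J (resp z) z <= J a z &
      forall z z', `|resp z - resp z'| <= lJ / l * `|z - z'|].
Proof.
have exists_min z : exists a, A a /\ forall x, A x -> J a z <= J x z.
  have [a Aa amin] := strongly_convex_minimum l0 Acvx (@Jder z)
    (fun a a' t => @Jcvx a a' z t) Acl A0.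
  by exists a.
have [resp hresp] := choice exists_min.
exists resp; split => [z|z|z z']; [by case: (hresp z)|by case: (hresp z)|].
have [Az zmin] := hresp z; have [Az' zmin'] := hresp z'.
exact: (argmin_lipschitz l0 lJ0 Acvx Jder Jcvx Jlip Az Az' zmin zmin').
Qed.

End best_response.

(** * Simultaneous extraction of convergent subsequences *)

Lemma ultra_fmap (T V : Type) (f : T -> V) (F : set_system T) :
  UltraFilter F -> UltraFilter (f @ F).
Proof.
move=> uF; split; first exact: fmap_proper_filter.
move=> G PG sFG; apply/predeqP => A; split; last exact: sFG.
move=> GA; have [//|FnA] := in_ultra_setVsetC (f @^-1` A) uF.
have GnA : G (~` A) by apply: sFG; rewrite /nbhs/= preimage_setC.
have := filterI GA GnA; rewrite setICr => G0.
have Gn0 : ~ G set0 by exact: filter_not_empty.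
by exfalso; apply: Gn0; exact: G0.
Qed.

(** Limits along an ultrafilter exist for all indices at once; the subsequence
    then approaches, at its [k]-th term, the limits of the first indices up
    to [k]. *)
Lemma diagonal_extraction (R : realType) (I : countType) (a : I -> nat -> R) (B : R) :
  (forall i n, `|a i n| <= B) ->
  exists s : nat -> nat, (forall k, (k <= s k)%N) /\
    forall i, cvg (a i (s k) @[k --> \oo]).
Proof.
move=> aB.
have [U [uU ooU]] := ultraFilterLemma (@eventually_filter : ProperFilter \oo).
have PU : ProperFilter U by exact: ultra_proper.
have lim_ex i : exists l : R, a i @ U --> l.
  have K : compact `[- B, B]%classic := @segment_compact R _ _.
  rewrite compact_ultra in K.
  have [|l [_ al]] := K (a i @ U) (ultra_fmap (a i) uU); last by exists l.
  by rewrite /nbhs/=; apply: filterE => n /=; rewrite in_itv/= -ler_norml.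
have {lim_ex}[l al] := choice lim_ex.
have close k : exists n, (k <= n)%N /\ forall i, (pickle i <= k)%N ->
    `|l i - a i n| < harmonic k.
  have Uk : U [set n | (k <= n)%N] by apply: ooU; exists k.
  have Ucl i : U [set n | `|l i - a i n| < harmonic k].
    by have /cvgrPdist_lt/(_ _ (harmonic_gt0 k)) := al i.
  have Uall : U [set n | forall j, (j <= k)%N -> forall i, pickle i = j -> `|l i - a i n| < harmonic k].
    elim: {1}k => [|m IH].
      case: (pselect (exists i : I, pickle i = 0%N)) => [[i0 i00]|no].
        apply: filterS (Ucl i0) => n h j; rewrite leqn0 => /eqP -> i ii.
        by have -> : i = i0 by apply: (pcan_inj pickleK); rewrite ii i00.
      apply: filterS filterT => n _ j; rewrite leqn0 => /eqP -> i ii.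
      by exfalso; apply: no; exists i.
    case: (pselect (exists i : I, pickle i = m.+1)) => [[i0 i00]|no].
      apply: filterS (filterI IH (Ucl i0)) => n [h1 h2] j.
      rewrite leq_eqVlt => /predU1P[-> i ii|]; last exact: h1.
      by have -> : i = i0 by apply: (pcan_inj pickleK); rewrite ii i00.
    apply: filterS IH => n h j; rewrite leq_eqVlt => /predU1P[-> i ii|]; last exact: h.
    by exfalso; apply: no; exists i.
  have UI : U [set n | (k <= n)%N /\ forall j, (j <= k)%N ->
      forall i, pickle i = j -> `|l i - a i n| < harmonic k] by exact: filterI.
  have [n [kn hn]] := filter_ex UI.
  by exists n; split => // i ik; apply: (hn _ ik).
have {close}[s hs] := choice close.
exists s; split => [k|i]; first by case: (hs k).
apply/cvg_ex; exists (l i); apply/cvgrPdist_lt => e e0.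
have := @cvg_harmonic R => /cvgrPdist_lt/(_ _ e0) he.
near=> k.
have [_ /(_ i) hk] := hs k.
apply: lt_trans (hk _) _; first by near: k; exact: nbhs_infty_ge.
rewrite -[ltLHS]ger0_norm ?harmonic_ge0// -normrN -sub0r.
by near: k.
Unshelve. all: by end_near.
Qed.

(** * Step functions over finer and finer cells *)

Lemma lipschitz_continuous (R : realType) (g : R -> R) (L : R) : 0 <= L ->
  (forall s t, `|g s - g t| <= L * `|s - t|) -> continuous g.
Proof.
move=> L0 glip x; apply/cvgrPdist_lt => e e0.
have L1 : 0 < L + 1 by rewrite ltr_wpDl.
have r0 : 0 < e / (L + 1) by rewrite divr_gt0.
have nx : \forall t \near x, `|x - t| < e / (L + 1) by apply: nbhsx_ballx.
near=> t; rewrite (le_lt_trans (glip _ _))//.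
apply: le_lt_trans (_ : (L + 1) * `|x - t| < _).
  by rewrite ler_wpM2r// lerDl.
by rewrite mulrC -ltr_pdivlMr//; near: t.
Unshelve. all: by end_near.
Qed.


(** [cell n] are [n + 1] disjoint sets of positive measure inside a set [D] of
    finite measure. From [cell_dense] on, step functions over [cell n] are
    assumed to approximate every integrable function as [n] grows. *)
Section cells.
Context d (T : measurableType d) (R : realType) (mu : {measure set T -> \bar R}).
Variables (D : set T) (cell : forall n, 'I_n.+1 -> set T).
Hypothesis mD : measurable D.
Hypothesis Dfin : (mu D < +oo)%E.
Hypothesis mcell : forall n i, measurable (@cell n i).
Hypothesis cellD : forall n i, @cell n i `<=` D.
Hypothesis cell_triv : forall n, trivIset setT (@cell n).
Hypothesis cell_gt0 : forall n i, (0 < mu (@cell n i))%E.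

Local Notation L1 h := (mu.-integrable D (EFin \o h)).

Definition cell_step n (a : 'I_n.+1 -> R) (y : T) : R :=
  \sum_i a i * \1_(cell i) y.

(** The integral over [D] of [h] times the step function with coefficients
    [c], see [Rintegral_step_mul]. The step functions [v_n] of the Galerkin
    method are only used through it. *)
Definition cell_pairing n (c : 'I_n.+1 -> R) (h : T -> R) : R :=
  \sum_i c i * \int[mu]_(y in cell i) h y.

Lemma cell_fin_num n (i : 'I_n.+1) : mu (cell i) \is a fin_num.
Proof.
rewrite ge0_fin_numE//; apply: le_lt_trans Dfin.
by apply: le_measure; rewrite ?inE//; exact: cellD.
Qed.

Lemma fine_cell_gt0 n (i : 'I_n.+1) : 0 < fine (mu (cell i)).
Proof. by rewrite fine_gt0// cell_gt0/= -ge0_fin_numE// cell_fin_num. Qed.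

Lemma L1_cell h n (i : 'I_n.+1) : L1 h -> mu.-integrable (cell i) (EFin \o h).
Proof. by apply: integrableS => //; exact: cellD. Qed.

Lemma L1_norm h : L1 h -> L1 (fun y => `|h y|).
Proof. exact: integrable_norm. Qed.

Lemma L1_bounded (u : T -> R) M : measurable_fun D u -> (forall y, `|u y| <= M) -> L1 u.
Proof.
move=> mu_ uM; apply: measurable_bounded_integrable => //.
by exists M; split; rewrite ?num_real// => x Mx y _; exact: le_trans (uM y) (ltW Mx).
Qed.

Lemma L1_mul_bounded h (u : T -> R) M : L1 h -> measurable_fun D u ->
  (forall y, `|u y| <= M) -> L1 (fun y => h y * u y).
Proof.
move=> ih mu_ uM; apply: (integrableMl mD ih mu_).
by exists M; split; rewrite ?num_real// => x Mx y _; exact: le_trans (uM y) (ltW Mx).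
Qed.

Lemma L1B h g : L1 h -> L1 g -> L1 (fun y => h y - g y).
Proof. exact: integrableB. Qed.

Lemma L1D h g : L1 h -> L1 g -> L1 (fun y => h y + g y).
Proof. exact: integrableD. Qed.

Lemma L1Z h (k : R) : L1 h -> L1 (fun y => k * h y).
Proof. by move=> ih; exact: (integrableZl mD k ih). Qed.

Lemma L1_sum (I : Type) (s : seq I) (h : I -> T -> R) :
  (forall i, L1 (h i)) -> L1 (fun y => \sum_(i <- s) h i y).
Proof.
move=> ih; apply: (@eq_integrable _ _ _ mu D mD (fun y => \sum_(i <- s) (h i y)%:E)%E).
  by move=> y _; rewrite /= sumEFin.
by apply: integrable_sum => // i _; exact: ih.
Qed.

Lemma L1_cst (k : R) : L1 (fun=> k).
Proof. by apply: (@L1_bounded _ `|k|). Qed.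

Lemma L1_indic n (i : 'I_n.+1) : L1 (\1_(cell i) : T -> R).
Proof.
apply: (@L1_bounded _ 1) => [|y]; first exact: measurable_indic.
by rewrite indicE; case: (_ \in _); rewrite ?normr1 ?normr0.
Qed.

Lemma L1_step n (a : 'I_n.+1 -> R) : L1 (cell_step a).
Proof.
by apply: L1_sum => i; apply: L1Z; exact: L1_indic.
Qed.

Lemma sum_cell_norm_le h n : L1 h ->
  \sum_(i < n.+1) \int[mu]_(y in cell i) `|h y| <= \int[mu]_(y in D) `|h y|.
Proof.
move=> /[dup] ih /L1_norm inh.
rewrite -lee_fin -sumEFin /Rintegral fineK; last exact: integrable_fin_num.
rewrite (eq_bigr (fun i : 'I_n.+1 => (\int[mu]_(y in cell i) (`|h y|)%:E)%E)); last first.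
  by move=> i _; rewrite fineK//; apply: integrable_fin_num => //; exact: L1_cell.
have mh := measurable_int mu inh.
have UD : \big[setU/set0]_(i < n.+1) cell i `<=` D.
  apply: (big_ind (fun B => B `<=` D)) => [|B C BD CD|i _].
  - exact: sub0set.
  - by rewrite subUset.
  - exact: cellD.
have mU : measurable (\big[setU/set0]_(i < n.+1) cell i) by exact: bigsetU_measurable.
rewrite -ge0_integral_bigsetU//.
- by apply: ge0_subset_integral => // x _; rewrite lee_fin.
- exact: index_enum_uniq.
- by move=> i j _ _; exact: (@cell_triv n i j I I).
- exact: (measurable_funS mD UD mh).
Qed.

Lemma cell_pairingB n (c : 'I_n.+1 -> R) h g : L1 h -> L1 g ->
  cell_pairing c (fun y => h y - g y) = cell_pairing c h - cell_pairing c g.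
Proof.
move=> ih ig; rewrite /cell_pairing -sumrB; apply: eq_bigr => i _.
by rewrite RintegralB// ?mulrBr//; exact: L1_cell.
Qed.

Lemma cell_pairing_le n (c : 'I_n.+1 -> R) h M : (forall i, `|c i| <= M) -> L1 h ->
  `|cell_pairing c h| <= M * \int[mu]_(y in D) `|h y|.
Proof.
move=> cM ih; have M0 : 0 <= M := le_trans (normr_ge0 _) (cM ord0).
apply: le_trans (ler_wpM2l M0 (sum_cell_norm_le n ih)).
rewrite mulr_sumr (le_trans (ler_norm_sum _ _ _))//; apply: ler_sum => i _.
rewrite normrM ler_pM//; apply: le_normr_Rintegral => //; exact: L1_cell.
Qed.

Lemma Rintegral_cell h n (i : 'I_n.+1) :
  \int[mu]_(y in cell i) h y = \int[mu]_(y in D) (h y * \1_(cell i) y).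
Proof.
rewrite -[in LHS](setIidr (@cellD _ i)) Rintegral_mkcondr.
by apply: eq_Rintegral => y _; rewrite patchE indicE; case: ifP => _; rewrite ?mulr1 ?mulr0.
Qed.

Lemma L1_mul_indic h n (i : 'I_n.+1) : L1 h -> L1 (fun y => h y * \1_(cell i) y).
Proof.
move=> ih; apply: (@L1_mul_bounded _ _ 1) => // y.
by rewrite indicE; case: (_ \in _); rewrite ?normr1 ?normr0.
Qed.

Lemma Rintegral_step_mul h n (a : 'I_n.+1 -> R) : L1 h ->
  \int[mu]_(y in D) (cell_step a y * h y) = \sum_i a i * \int[mu]_(y in cell i) h y.
Proof.
move=> ih; rewrite (@eq_Rintegral _ _ _ _ _
  (fun y => \sum_i a i * (h y * \1_(cell i) y))); last first.
  by move=> y _; rewrite mulr_suml; apply: eq_bigr => i _; rewrite mulrAC mulrA.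
have -> : forall s : seq 'I_n.+1, \int[mu]_(y in D) (\sum_(i <- s) a i * (h y * \1_(cell i) y)) =
    \sum_(i <- s) a i * \int[mu]_(y in cell i) h y; last by [].
elim=> [|i s IH].
  rewrite big_nil (@eq_Rintegral _ _ _ _ _ (fun=> 0)) ?Rintegral_cst ?mul0r// => y _.
  by rewrite big_nil.
rewrite big_cons -IH Rintegral_cell -RintegralZl//; last exact: L1_mul_indic.
rewrite -RintegralD//; first by apply: eq_Rintegral => y _; rewrite big_cons.
  by apply: L1Z; exact: L1_mul_indic.
by apply: L1_sum => j; apply: L1Z; exact: L1_mul_indic.
Qed.

Lemma cell_step_in n (a : 'I_n.+1 -> R) i y : cell i y -> cell_step a y = a i.
Proof.
move=> iy; rewrite /cell_step (bigD1 i)//= indicE mem_set// mulr1 big1 ?addr0// => j ji.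
rewrite indicE memNset ?mulr0// => jy.
have := @cell_triv n j i I I; move/eqP: ji => ji h; apply: ji; apply: h.
by exists y.
Qed.

Lemma Rintegral_cell_step n (a : 'I_n.+1 -> R) i :
  \int[mu]_(y in cell i) cell_step a y = a i * fine (mu (cell i)).
Proof.
rewrite -Rintegral_cst//; apply: eq_Rintegral => y /set_mem yi.
exact: cell_step_in.
Qed.

Lemma cell_pairing_step n m (c : 'I_n.+1 -> R) (a : 'I_m.+1 -> R) :
  cell_pairing c (cell_step a) = \sum_j a j * cell_pairing c (\1_(cell j)).
Proof.
rewrite /cell_pairing; under [RHS]eq_bigr do rewrite mulr_sumr.
rewrite exchange_big/=; apply: eq_bigr => i _.
rewrite Rintegral_cell Rintegral_step_mul; last first.
  exact: L1_indic.
rewrite mulr_sumr; apply: eq_bigr => j _; rewrite mulrCA; congr (_ * (_ * _)).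
by rewrite [LHS]Rintegral_cell [RHS]Rintegral_cell; apply: eq_Rintegral => y _; rewrite mulrC.
Qed.


Hypothesis cell_dense : forall h, L1 h -> forall e : R, 0 < e ->
  exists N, forall n, (N <= n)%N -> exists a : 'I_n.+1 -> R,
    \int[mu]_(y in D) `|h y - cell_step a y| <= e.

(** Uniformly bounded step functions define equicontinuous functionals on L^1,
    so convergence on the dense set of step functions, which follows from
    convergence on indicators of cells, extends to all of L^1. *)
Lemma cvg_cell_pairing (s : nat -> nat) (c : forall n, 'I_n.+1 -> R) M :
  (forall n i, `|c n i| <= M) ->
  (forall m (j : 'I_m.+1), cvg (cell_pairing (c (s k)) (\1_(cell j)) @[k --> \oo])) ->
  forall h, L1 h -> cvg (cell_pairing (c (s k)) h @[k --> \oo]).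
Proof.
move=> cM ccvg h ih; apply: cauchy_cvg; apply: cauchy_exP => e e0.
have M0 : 0 <= M := le_trans (normr_ge0 _) (cM 0%N ord0).
pose e' := e / (2 * (M + 1)).
have M1 : 0 < 2 * (M + 1) by rewrite mulr_gt0// ltr_wpDl.
have e'0 : 0 < e' by rewrite divr_gt0.
have [N /(_ N (leqnn N))[a ha]] := cell_dense ih e'0.
pose l := \sum_j a j * lim (cell_pairing (c (s k)) (\1_(cell j)) @[k --> \oo]).
have cl : cell_pairing (c (s k)) (cell_step a) @[k --> \oo] --> l.
  under eq_fun do rewrite cell_pairing_step.
  by apply: cvg_big => [|j _]; [exact: add_continuous|apply: cvgMl_tmp; exact: ccvg].
exists l; rewrite /nbhs/=.
have /cvgrPdist_lt/(_ (e / 2)) := cl; rewrite divr_gt0// => /(_ isT) nl.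
near=> k; rewrite -ball_normE/=.
have -> : l - cell_pairing (c (s k)) h = (l - cell_pairing (c (s k)) (cell_step a))
   - cell_pairing (c (s k)) (fun y => h y - cell_step a y).
  by rewrite cell_pairingB//; [ring|exact: L1_step].
rewrite (le_lt_trans (ler_normB _ _))// [ltRHS]splitr ltr_leD//; first by near: k.
apply: le_trans (cell_pairing_le (cM _) _) _; first by apply: L1B => //; exact: L1_step.
apply: le_trans (ler_wpM2l M0 ha) _.
have : e' * (2 * (M + 1)) = e by rewrite divfK// gt_eqF.
by move: e'0; lra.
Unshelve. all: by end_near.
Qed.

(** If [u n] has almost the means [c n] on the cells of order [n], then the
    step function of coefficients [c n] and [u n] are weakly asymptotic: against
    a step function over the same cells they differ by a vanishing amount, and
    every integrable [h] is close to such a step function. *)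
Lemma cell_pairing_defect (c : forall n, 'I_n.+1 -> R) (u : nat -> T -> R) M :
  (forall n i, `|c n i| <= M) ->
  (forall n y, `|u n y| <= M) -> (forall n, measurable_fun D (u n)) ->
  (forall n i, `|c n i * fine (mu (cell i)) - \int[mu]_(y in cell i) u n y|
     <= harmonic n * fine (mu (cell i))) ->
  forall h, L1 h ->
    cell_pairing (c n) h - \int[mu]_(y in D) (h y * u n y) @[n --> \oo] --> 0.
Proof.
move=> cM uM um cu h ih.
have M0 : 0 <= M := le_trans (normr_ge0 _) (cM 0%N ord0).
have iu n : L1 (u n) := L1_bounded (um n) (uM n).
have same n (a : 'I_n.+1 -> R) : `|cell_pairing (c n) (cell_step a) -
    \int[mu]_(y in D) (cell_step a y * u n y)| <=
    harmonic n * \int[mu]_(y in D) `|cell_step a y|.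
  have ia := L1_step a.
  apply: le_trans (ler_wpM2l (harmonic_ge0 n) (sum_cell_norm_le n ia)).
  rewrite Rintegral_step_mul// /cell_pairing -sumrB mulr_sumr.
  rewrite (le_trans (ler_norm_sum _ _ _))//; apply: ler_sum => i _.
  rewrite Rintegral_cell_step mulrCA -mulrBr normrM.
  have -> : \int[mu]_(y in cell i) `|cell_step a y| = `|a i| * fine (mu (cell i)).
    rewrite -Rintegral_cst//; apply: eq_Rintegral => y /set_mem yi.
    by rewrite (cell_step_in _ yi).
  by rewrite mulrCA ler_wpM2l.
apply/cvgrPdist_lt => e e0.
pose e' := e / (3 * (M + 1)).
have M1 : 0 < M + 1 by rewrite ltr_wpDl.
have e'0 : 0 < e' by rewrite divr_gt0// mulr_gt0.
have [N hN] := cell_dense ih e'0.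
pose H := \int[mu]_(y in D) `|h y| + e'.
have H0 : 0 < H by rewrite ltr_wpDl// Rintegral_ge0.
have /cvgrPdist_lt/(_ (e / (3 * H))) := @cvg_harmonic R.
rewrite divr_gt0// ?mulr_gt0// => /(_ isT) nh.
near=> n; rewrite sub0r normrN.
have [a ha] : exists a : 'I_n.+1 -> R, \int[mu]_(y in D) `|h y - cell_step a y| <= e'.
  by apply: hN; near: n; exact: nbhs_infty_ge.
have ia := L1_step a.
have id := L1B ih ia.
have p1 : `|cell_pairing (c n) (fun y => h y - cell_step a y)| <= M * e'.
  by rewrite (le_trans (cell_pairing_le (cM n) id))// ler_wpM2l.
have p2 : `|\int[mu]_(y in D) ((h y - cell_step a y) * u n y)| <= M * e'.
  apply: le_trans (le_normr_Rintegral mD (L1_mul_bounded id (um n) (uM n))) _.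
  apply: le_trans (ler_wpM2l M0 ha).
  rewrite -RintegralZl//; last exact: L1_norm.
  apply: le_Rintegral => //.
  - exact: L1_norm (L1_mul_bounded id (um n) (uM n)).
  - exact: L1Z (L1_norm id).
  - by move=> y _; rewrite normrM mulrC ler_wpM2r.
have p3 : \int[mu]_(y in D) `|cell_step a y| <= H.
  apply: le_trans (_ : \int[mu]_(y in D) (`|h y| + `|h y - cell_step a y|) <= _).
    apply: le_Rintegral => //; first exact: L1_norm.
      by apply: L1D; exact: L1_norm.
    by move=> y _; rewrite -{1}[cell_step a y](subKr (h y)) (le_trans (ler_normB _ _)).
  by rewrite RintegralD// ?lerD2l//; exact: L1_norm.
have hn : harmonic n * H < e / 3.
  rewrite -ltr_pdivlMr// -mulrA -invfM.
  have : `|0 - harmonic n| < e / (3 * H) by near: n.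
  by rewrite sub0r normrN ger0_norm ?harmonic_ge0.
have -> : cell_pairing (c n) h - \int[mu]_(y in D) (h y * u n y) =
   cell_pairing (c n) (fun y => h y - cell_step a y)
   - \int[mu]_(y in D) ((h y - cell_step a y) * u n y)
   + (cell_pairing (c n) (cell_step a) - \int[mu]_(y in D) (cell_step a y * u n y)).
  rewrite cell_pairingB// (_ : \int[mu]_(y in D) ((h y - cell_step a y) * u n y) =
      \int[mu]_(y in D) (h y * u n y - cell_step a y * u n y)).
    by rewrite RintegralB//; [ring|exact: L1_mul_bounded (um n) (uM n)..].
  by apply: eq_Rintegral => y _; rewrite mulrBl.
have := same n a; have := ler_wpM2l (harmonic_ge0 n) p3.
have Me : M * e' <= e / 3.
  have : e' * (3 * (M + 1)) = e by rewrite divfK// gt_eqF// mulr_gt0.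
  by move: e'0; lra.
move=> q1 q2; rewrite (le_lt_trans (ler_normD _ _))//.
rewrite (le_lt_trans (lerD (ler_normB _ _) (le_refl _)))//.
move: p1 p2 q1 q2 hn Me; lra.
Unshelve. all: by end_near.
Qed.

(** * Hammerstein equations by the Galerkin method *)

Section hammerstein.
Variables (w : T -> T -> R) (beta : R -> R) (M L : R).
Hypothesis w_L1 : forall x, L1 (w x).
Hypothesis w_meas : forall n (i : 'I_n.+1),
  measurable_fun D (fun x => \int[mu]_(y in cell i) w x y).
Hypothesis w_rows_L1 : L1 (fun x => \int[mu]_(y in D) `|w x y|).
Hypothesis M0 : 0 < M.
Hypothesis L0 : 0 <= L.
Hypothesis beta_bounded : forall t, `|beta t| <= M.
Hypothesis beta_lip : forall s t, `|beta s - beta t| <= L * `|s - t|.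

Let beta_continuous : continuous beta := lipschitz_continuous L0 beta_lip.

Let u n (c : 'I_n.+1 -> R) x : R := beta (cell_pairing c (w x)).

Lemma measurable_pairing n (c : 'I_n.+1 -> R) :
  measurable_fun D (fun x => cell_pairing c (w x)).
Proof.
by apply: measurable_sum => i; apply: measurable_funM.
Qed.

Lemma measurable_beta_pairing n (c : 'I_n.+1 -> R) : measurable_fun D (u c).
Proof.
apply: measurableT_comp; last exact: measurable_pairing.
exact: continuous_measurable_fun beta_continuous.
Qed.

Let u_L1 n (c : 'I_n.+1 -> R) : L1 (u c).
Proof. exact: L1_bounded (measurable_beta_pairing c) (fun=> beta_bounded _). Qed.

(** The step function with coefficients [c] has on each cell nearly the mean
    value of [beta (W v)], where [W v] is [fun x => cell_pairing c (w x)]. *)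
Lemma galerkin_solution n : exists c : 'I_n.+1 -> R, (forall i, `|c i| <= M) /\
  forall i, `|c i * fine (mu (cell i)) - \int[mu]_(x in cell i) u c x|
    <= harmonic n * fine (mu (cell i)).
Proof.
pose F (c : 'I_n.+1 -> R) (i : 'I_n.+1) := \int[mu]_(x in cell i) u c x / fine (mu (cell i)).
pose kappa x := \int[mu]_(y in D) `|w x y|.
(* The Lipschitz constant of the mean over one cell, summed over the cells to
   get one constant for all coordinates. *)
pose K := \sum_(i < n.+1) L * (\int[mu]_(x in cell i) kappa x / fine (mu (cell i))).
have kappa_ge0 (i : 'I_n.+1) : 0 <= L * (\int[mu]_(x in cell i) kappa x / fine (mu (cell i))).
  rewrite mulr_ge0// divr_ge0 ?(ltW (fine_cell_gt0 _))// Rintegral_ge0// => x _.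
  exact: Rintegral_ge0.
have K0 : 0 <= K by exact: sumr_ge0.
have FM (c : 'I_n.+1 -> R) i : (forall j, `|c j| <= M) -> `|F c i| <= M.
  move=> cM; rewrite normrM normfV (gtr0_norm (fine_cell_gt0 _)).
  rewrite ler_pdivrMr ?fine_cell_gt0//.
  rewrite (le_trans (le_normr_Rintegral _ (L1_cell _ (u_L1 c))))// -Rintegral_cst//.
  apply: le_Rintegral => //; first exact: L1_cell (L1_norm (u_L1 c)).
    by apply: L1_cell; exact: L1_cst.
  by move=> x _; exact: beta_bounded.
have Flip : forall (c c' : 'I_n.+1 -> R) (delta : R) i,
    (forall j, `|c j| <= M) -> (forall j, `|c' j| <= M) ->
    (forall j, `|c j - c' j| <= delta) -> `|F c i - F c' i| <= K * delta.
  move=> c c' delta i _ _ cc'.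
  have delta0 : 0 <= delta := le_trans (normr_ge0 _) (cc' ord0).
  apply: le_trans
    (_ : L * (\int[mu]_(x in cell i) kappa x / fine (mu (cell i))) * delta <= _);
    last first.
    by rewrite ler_wpM2r// /K (bigD1 i)//= lerDl sumr_ge0.
  rewrite -mulrBl normrM normfV (gtr0_norm (fine_cell_gt0 _)).
  rewrite ler_pdivrMr ?fine_cell_gt0// mulrA mulrAC divfK ?gt_eqF ?fine_cell_gt0//.
  have iB := L1B (u_L1 c) (u_L1 c').
  rewrite -RintegralB//; [|exact: L1_cell..].
  rewrite (le_trans (le_normr_Rintegral _ (L1_cell _ iB)))//.
  rewrite mulrAC -RintegralZl//; last exact: L1_cell.
  apply: le_Rintegral => //; first exact: L1_cell (L1_norm iB).
    by apply: L1_cell; exact: L1Z.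
  move=> x _; rewrite (le_trans (beta_lip _ _))// -mulrA ler_wpM2l//.
  have -> : cell_pairing c (w x) - cell_pairing c' (w x) = cell_pairing (fun j => c j - c' j) (w x).
    by rewrite /cell_pairing -sumrB; apply: eq_bigr => j _; rewrite mulrBl.
  exact: cell_pairing_le.
have [c [cM Fc]] := lipschitz_approx_fixpoint M0 K0 FM Flip (harmonic_gt0 n).
exists c; split => // i; have := Fc i; rewrite distrC /F => h.
rewrite -[X in _ - X](@divfK _ (fine (mu (cell i)))) ?gt_eqF ?fine_cell_gt0//.
by rewrite -mulrBl normrM (gtr0_norm (fine_cell_gt0 _)) ler_wpM2r// ltW// fine_cell_gt0.
Qed.

(** Along a subsequence the Galerkin step functions converge weakly, so their
    images under the kernel converge at every point, to [z]. Their weak limit is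
    [beta z], the pointwise limit of the functions whose means they share. *)
Theorem hammerstein_solution : exists z : T -> R, measurable_fun D z /\
  forall x, D x -> z x = \int[mu]_(y in D) (w x y * beta (z y)).
Proof.
pose c n := sval (cid (galerkin_solution n)).
have [cM cdef] : (forall n i, `|c n i| <= M) /\
    forall n i, `|c n i * fine (mu (cell i)) - \int[mu]_(x in cell i) u (c n) x|
      <= harmonic n * fine (mu (cell i)).
  by split=> n; have [] := svalP (cid (galerkin_solution n)).
pose a (p : {m & 'I_m.+1}) n := cell_pairing (c n) (\1_(cell (projT2 p))).
have aB p n : `|a p n| <= M * fine (mu D).
  rewrite (le_trans (cell_pairing_le (cM n) (L1_indic _)))// ler_wpM2l ?(ltW M0)//.
  rewrite -[leRHS]mul1r -Rintegral_cst//; apply: le_Rintegral => //.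
  - exact: L1_norm (L1_indic _).
  - exact: L1_cst.
  - by move=> y _; rewrite indicE; case: (_ \in _); rewrite ?normr1 ?normr0.
have [s [sk acvg]] := diagonal_extraction aB.
have zcvg h : L1 h -> cvg (cell_pairing (c (s k)) h @[k --> \oo]).
  apply: (cvg_cell_pairing (s := s) cM) => m j.
  exact: (acvg (existT _ m j)).
pose zk k x := cell_pairing (c (s k)) (w x).
pose z x := lim (zk k x @[k --> \oo]).
have zk_z x : zk k x @[k --> \oo] --> z x by exact: zcvg.
exists z; split.
  apply: (measurable_fun_cvg (h := zk)) => [k|x _]; last exact: zk_z.
  exact: measurable_pairing.
move=> x Dx.
have s_oo : s @ \oo --> \oo.
  move=> P [N _ NP]; exists N => // k /= Nk; apply: NP => /=.
  exact: leq_trans Nk (sk k).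
(* The rows [w x] serve as test functions for the weak limits. *)
have defect : cell_pairing (c n) (w x) -
    \int[mu]_(y in D) (w x y * u (c n) y) @[n --> \oo] --> 0.
  apply: (cell_pairing_defect (u := fun n => u (c n)) cM) => //.
    by move=> n y; exact: beta_bounded.
  by move=> n; exact: measurable_beta_pairing.
have dom : \int[mu]_(y in D) (w x y * u (c (s k)) y) @[k --> \oo] -->
    \int[mu]_(y in D) (w x y * beta (z y)).
  have iw := w_L1 x.
  apply: fine_cvg; rewrite fineK; last first.
    apply: integrable_fin_num => //; apply: (@L1_mul_bounded _ _ M) => //.
    apply: measurableT_comp; first exact: continuous_measurable_fun beta_continuous.
    apply: (measurable_fun_cvg (h := zk)) => [k|y _]; last exact: zk_z.
    exact: measurable_pairing.
  apply: (@dominated_cvg _ _ _ mu D mD _ _ (fun y => (M * `|w x y|)%:E)) => //.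
  - move=> k; apply/measurable_EFinP; apply: measurable_funM; last exact: measurable_beta_pairing.
    exact/measurable_EFinP/(measurable_int mu iw).
  - move=> y Dy; apply: cvg_EFin; first exact: nearW.
    apply: cvgMl_tmp; apply: continuous_cvg; last exact: zk_z.
    exact: beta_continuous.
  - exact: L1Z (L1_norm iw).
  - move=> k y _; rewrite /= lee_fin normrM [M * _]mulrC ler_wpM2l//.
    exact: beta_bounded.
have dk := cvg_comp _ _ s_oo defect.
apply/eqP; rewrite -subr_eq0; apply/eqP.
have h : zk k x - \int[mu]_(y in D) (w x y * u (c (s k)) y) @[k --> \oo] -->
    z x - \int[mu]_(y in D) (w x y * beta (z y)).
  by apply: cvgB; [exact: zk_z|exact: dom].
have h1 := cvg_lim (@Rhausdorff R) h; have h2 := cvg_lim (@Rhausdorff R) dk.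
by rewrite -[LHS]h1 -[RHS]h2.
Qed.

End hammerstein.
End cells.

(** * Uniform subdivisions of the unit interval *)

Section unit_cells.
Variable R : realType.
Local Notation leb := (@lebesgue_measure R).

Definition unit_cell n (i : 'I_n.+1) : set (measurableTypeR R) :=
  `[i%:R / n.+1%:R, i.+1%:R / n.+1%:R[%classic.

Lemma measurable_unitI : measurable (@unitI R : set (measurableTypeR R)).
Proof. exact: measurable_itv. Qed.

Lemma lebesgue_unitI : leb (@unitI R) = 1%E.
Proof. by rewrite lebesgue_measure_itv/= lte_fin ltr01 -EFinB subr0. Qed.

Lemma measurable_unit_cell n (i : 'I_n.+1) : measurable (unit_cell i).
Proof. exact: measurable_itv. Qed.

Lemma unit_cell_unitI n (i : 'I_n.+1) : unit_cell i `<=` unitI.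
Proof.
move=> y; rewrite /unit_cell /unitI /= !in_itv/= => /andP[iy yi].
rewrite (le_trans _ iy) ?divr_ge0//= (le_trans (ltW yi))//.
by rewrite ler_pdivrMr// mul1r ler_nat.
Qed.

Lemma in_unit_cell n (i : 'I_n.+1) (y : R) : 0 <= y ->
  unit_cell i y <-> Num.truncn (y * n.+1%:R) = i.
Proof.
move=> y0; rewrite /unit_cell /= in_itv/= ler_pdivrMr// ltr_pdivlMr//.
have y0' : 0 <= y * n.+1%:R by rewrite mulr_ge0.
by rewrite -truncn_eq//; split => [/eqP|/eqP].
Qed.

Lemma trivIset_unit_cell n : trivIset setT (@unit_cell n).
Proof.
move=> i j _ _ [y [yi yj]].
have y0 : 0 <= y by have := unit_cell_unitI yi; rewrite /unitI/= in_itv/= => /andP[].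
by apply: val_inj; rewrite /= -((in_unit_cell i y0).1 yi) ((in_unit_cell j y0).1 yj).
Qed.

Lemma lebesgue_unit_cell_gt0 n (i : 'I_n.+1) : (0 < leb (unit_cell i))%E.
Proof.
rewrite lebesgue_measure_itv/= lte_fin ltr_pM2r ?invr_gt0// ltr_nat ltnSn.
by rewrite -EFinB lte_fin subr_gt0 ltr_pM2r ?invr_gt0// ltr_nat.
Qed.

Lemma unit_cell_cover n (y : R) : 0 <= y -> y < 1 -> exists i : 'I_n.+1, unit_cell i y.
Proof.
move=> y0 y1; have lt_n : (Num.truncn (y * n.+1%:R) < n.+1)%N.
  rewrite truncn_lt_nat ?mulr_ge0//.
  by rewrite -[ltRHS]mul1r ltr_pM2r.
by exists (Ordinal lt_n); apply/in_unit_cell.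
Qed.

Let left_end n (i : 'I_n.+1) : R := i%:R / n.+1%:R.

(** Sampling a continuous function at the left ends of the cells converges
    pointwise because the cell of order [n] around [y] has length
    [1 / (n + 1)]. *)
Lemma cell_step_cvg (g : R -> R) y : continuous g -> 0 <= y -> y < 1 ->
  cell_step unit_cell (fun i : 'I_n.+1 => g (left_end i)) y @[n --> \oo] --> g y.
Proof.
move=> cg y0 y1.
pose p n : R := (Num.truncn (y * n.+1%:R))%:R / n.+1%:R.
have py : p n @[n --> \oo] --> y.
  apply/cvgrPdist_lt => e e0.
  have /cvgrPdist_lt/(_ _ e0) := @cvg_harmonic R.
  apply: filterS => n; rewrite sub0r normrN ger0_norm ?harmonic_ge0//; apply: le_lt_trans.
  have := @truncn_itv R (y * n.+1%:R); rewrite mulr_ge0// => /(_ isT)/andP[h1 h2].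
  have n0 : 0 < n.+1%:R :> R by [].
  have -> : y - p n = (y * n.+1%:R - (Num.truncn (y * n.+1%:R))%:R) / n.+1%:R.
    by rewrite mulrBl mulfK// gt_eqF.
  rewrite normrM normfV (gtr0_norm n0) ler_pdivrMr//= mulVf ?gt_eqF//.
  by rewrite ger0_norm ?subr_ge0// lerBlDl natr1 ltW.
have gp : g (p n) @[n --> \oo] --> g y by apply: continuous_cvg; [exact: cg|exact: py].
apply: cvg_trans gp.
apply: near_eq_cvg; apply: nearW => n.
have [i yi] := unit_cell_cover n y0 y1.
rewrite (cell_step_in (@trivIset_unit_cell) _ yi) /left_end /p.
by rewrite (in_unit_cell i y0).1.
Qed.

(** Continuous functions are dense in L^1 and are approximated by their samples
    at the left ends of the cells, by dominated convergence. The cells cover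
    [0, 1[ only, which has full measure. *)
Lemma unit_cell_dense (h : R -> R) : leb.-integrable unitI (EFin \o h) ->
  forall e : R, 0 < e -> exists N, forall n, (N <= n)%N ->
  exists a : 'I_n.+1 -> R,
    \int[leb]_(y in unitI) `|h y - cell_step unit_cell a y| <= e.
Proof.
move=> ih e e0.
have mI := measurable_unitI.
have I_fin : (leb unitI < +oo)%E by rewrite lebesgue_unitI ltry.
have e20 : 0 < e / 2 by rewrite divr_gt0.
have [gn [gc ig gh]] := approximation_continuous_integrable mI I_fin ih.
have [g [cg ig' hg]] : exists g, [/\ continuous g, leb.-integrable unitI (EFin \o g) &
    \int[leb]_(y in unitI) `|h y - g y| <= e / 2].
  have : \forall n \near \oo, (\int[leb]_(z in unitI) `|(h z - gn n z)%:E| < (e / 2)%:E)%E.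
    have : nbhs 0%E [set y : \bar R | (y < (e / 2)%:E)%E].
      by apply: open_nbhs_nbhs; split; [exact: open_ereal_lt_ereal|rewrite /= lte_fin].
    exact: gh.
  move=> /filter_ex[n hn]; exists (gn n); split => //.
  rewrite -lee_fin fineK; first exact: ltW.
  apply: integrable_fin_num => //.
  exact: L1_norm (L1B mI ih (ig n)).
pose step n := cell_step unit_cell (fun i : 'I_n.+1 => g (left_end i)).
have istep n : leb.-integrable unitI (EFin \o step n).
  exact: (L1_step (mu := leb) mI I_fin measurable_unit_cell).
suff : \forall n \near \oo, \int[leb]_(y in unitI) `|g y - step n y| <= e / 2.
  move=> [N _ hN]; exists N => n /hN /= {}hN.
  exists (fun i => g (left_end i)); rewrite -/(step n).
  rewrite [leRHS]splitr; apply: le_trans (lerD hg hN).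
  have i1 := L1_norm (L1B mI ih ig').
  have i2 := L1_norm (L1B mI ig' (istep n)).
  rewrite -RintegralD//; apply: le_Rintegral => //.
  - exact: L1_norm (L1B mI ih (istep n)).
  - exact: L1D.
  - by move=> y _; rewrite (le_trans _ (ler_normD _ _))// subrKA.
have [G hG] : exists G, forall y, unitI y -> `|g y| <= G.
  have : compact (g @` `[0, 1]%classic).
    apply: continuous_compact; last exact: segment_compact.
    exact: continuous_subspaceT.
  move=> /compact_bounded[G [_ hG]]; exists (G + 1) => y y01.
  by apply: (hG (G + 1)); [rewrite ltrDl|exists y].
pose J : set (measurableTypeR R) := `[0, 1[%classic.
have mJ : measurable J by exact: measurable_itv.
have JI : J `<=` unitI.
  by move=> y; rewrite /J /unitI/= !in_itv/= => /andP[-> /ltW].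
have I_J n : \int[leb]_(y in unitI) `|g y - step n y| = \int[leb]_(y in J) `|g y - step n y|.
  rewrite /J /unitI -Rintegral_itv_bndo_bndc//.
  apply: (integrableS mI mJ JI).
  exact: L1_norm (L1B mI ig' (istep n)).
have : \int[leb]_(y in J) `|g y - step n y| @[n --> \oo] --> \int[leb]_(y in J) (0 : R).
  apply: fine_cvg; rewrite fineK; last first.
    by rewrite integral0.
  apply: (@dominated_cvg _ _ _ leb J mJ _ _ (fun y => (G + G)%:E)) => //.
  - move=> n; apply/measurable_EFinP.
    have /measurable_EFinP := measurable_int leb (L1_norm (L1B mI ig' (istep n))).
    exact: measurable_funS.
  - move=> y; rewrite /J/= in_itv/= => /andP[y0 y1].
    apply: cvg_EFin; first exact: nearW.
    rewrite -(normr0 R) -(subrr (g y)); apply: cvg_norm; apply: cvgB; first exact: cvg_cst.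
    exact: cell_step_cvg.
  - apply: (integrableS mI mJ JI).
    exact: L1_cst.
  - move=> n y Jy; have := JI _ Jy; move: Jy; rewrite /J/= in_itv/= => /andP[y0 y1] Iy.
    rewrite lee_fin normr_id (le_trans (ler_normB _ _))// lerD ?hG//.
    have [i yi] := unit_cell_cover n y0 y1.
    rewrite /step (cell_step_in (@trivIset_unit_cell) _ yi) hG//.
    by rewrite /unitI/= in_itv/= divr_ge0//= ler_pdivrMr// mul1r ler_nat ltnW.
rewrite Rintegral_cst// mul0r => /cvgrPdist_lt/(_ _ e20).
apply: filterS => n; rewrite sub0r normrN I_J ger0_norm; first exact: ltW.
exact: Rintegral_ge0.
Qed.

End unit_cells.

(** * Square-integrable kernels *)

Section square_integrable.
Context d (T : measurableType d) (R : realType) (mu : {measure set T -> \bar R}).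
Variables (D : set T).
Hypothesis mD : measurable D.
Implicit Types f : T -> R.

Let sqr_restrict f : (fun x => (f \_ D) x ^+ 2) = (fun x => f x ^+ 2) \_ D.
Proof. by apply/funext => x; rewrite !patchE; case: ifP => _ //; rewrite expr0n. Qed.

Let integral_sqr_restrict f :
  (\int[mu]_x (`|((f \_ D) x)%:E| `^ 2) = \int[mu]_(x in D) (f x ^+ 2)%:E)%E.
Proof.
rewrite [RHS]integral_mkcond; apply: eq_integral => x _.
rewrite /= powR_mulrn// !patchE.
by case: ifP => _; rewrite ?normr0 ?expr0n//= real_normK ?num_real.
Qed.

Lemma in_L2P f : in_L2 mu D f <->
  measurable_fun D f /\ mu.-integrable D (EFin \o (fun x => f x ^+ 2)).
Proof.
split=> [f2|[mf f2]].
  split.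
    move: f2; rewrite /in_L2 inE => /andP[+ _]; rewrite inE/= => mf.
    exact: (measurable_restrictT f mD).2.
  have := Lfun2_integrable_sqr f2; rewrite sqr_restrict => h.
  by apply/integrable_mkcond => //; rewrite restrict_EFin.
rewrite /in_L2 inE; apply/andP; split; rewrite inE/=.
  exact: (measurable_restrictT f mD).1.
rewrite /finite_norm unlock poweR_lty//= integral_sqr_restrict.
exact: (integrable_lty mD f2).
Qed.

Lemma normL2_poweR f : normL2 mu D f = ((\int[mu]_(x in D) (f x ^+ 2)%:E) `^ 2^-1)%E.
Proof. by rewrite /normL2 unlock/= integral_sqr_restrict. Qed.

Lemma eq_normL2 f g : measurable_fun D f -> measurable_fun D g ->
  {ae mu, forall x, D x -> f x = g x} -> normL2 mu D f = normL2 mu D g.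
Proof.
move=> mf mg fg; rewrite !normL2_poweR; congr (_ `^ _)%E; apply: ae_eq_integral => //.
- by apply/measurable_EFinP; exact: measurable_funX.
- by apply/measurable_EFinP; exact: measurable_funX.
- by apply: filterS fg => x h Dx; rewrite h.
Qed.

Lemma normL2E f : in_L2 mu D f ->
  normL2 mu D f = (Num.sqrt (\int[mu]_(x in D) f x ^+ 2))%:E.
Proof.
move=> /in_L2P[mf f2]; rewrite normL2_poweR.
rewrite -[X in (X `^ _)%E]fineK ?integrable_fin_num// poweR_EFin powR12_sqrt//.
by apply: Rintegral_ge0 => x _; exact: sqr_ge0.
Qed.

End square_integrable.

(** Fubini for functions that are integrable over [D `*` D] and whose values
    elsewhere are arbitrary. *)
Section sections.
Context d (T : measurableType d) (R : realType)
  (mu : {sigma_finite_measure set T -> \bar R}) (D : set T).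
Hypothesis mD : measurable D.
Variable q : T * T -> R.
Hypothesis iq : (mu \x mu)%E.-integrable (D `*` D) (EFin \o q).

Let Q := (EFin \o q) \_ (D `*` D).

Let iQ : (mu \x mu)%E.-integrable setT Q.
Proof.
have mDD : measurable (D `*` D) by exact: measurableX.
by have [h _] := @integrable_mkcond _ _ _ (mu \x mu)%E (D `*` D) (EFin \o q) mDD; exact: h.
Qed.

Let Q_section x : D x -> (fun y => Q (x, y)) = (fun y => (q (x, y))%:E) \_ D.
Proof.
move=> Dx; apply/funext => y; rewrite /Q !patchE.
suff -> : ((x, y) \in D `*` D) = (y \in D) by [].
by apply/idP/idP => /set_mem h; apply/mem_set => //; case: h.
Qed.

Let fineF x : D x -> \int[mu]_(y in D) q (x, y) = fine (fubini_F mu Q x).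
Proof. by move=> Dx; rewrite /fubini_F Q_section// -integral_mkcond. Qed.

Lemma ae_section_L1 :
  {ae mu, forall x, D x -> mu.-integrable D (EFin \o (fun y => q (x, y)))}.
Proof.
have := ae_integrable1 iQ; apply: filterS => x + Dx.
by rewrite Q_section// => h; apply/integrable_mkcond.
Qed.

Lemma measurable_section_Rintegral :
  measurable_fun D (fun x => \int[mu]_(y in D) q (x, y)).
Proof.
apply: (@eq_measurable_fun _ _ _ _ D (fun x => fine (fubini_F mu Q x))).
  by move=> x /set_mem Dx; rewrite fineF.
apply: measurable_funTS; apply: measurableT_comp => //.
exact: measurable_fubini_F iQ.
Qed.

Lemma section_Rintegral_L1 :
  mu.-integrable D (EFin \o (fun x => \int[mu]_(y in D) q (x, y))).
Proof.
apply: (@le_integrable _ _ _ mu D mD _ (fubini_F mu Q)).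
- exact/measurable_EFinP/measurable_section_Rintegral.
- move=> x Dx; rewrite /= fineF//.
  by case: (fubini_F mu Q x) => //= *; rewrite ?normr0 ?leey.
- apply: (integrableS _ _ _ (integrable_fubini_F iQ)) => //.
Qed.

End sections.

Section L2_kernel.
Context d (T : measurableType d) (R : realType)
  (mu : {sigma_finite_measure set T -> \bar R}) (D : set T).
Variables (cell : forall n, 'I_n.+1 -> set T).
Hypothesis mD : measurable D.
Hypothesis muD : mu D = 1%E.
Hypothesis mcell : forall n i, measurable (@cell n i).
Hypothesis cellD : forall n i, @cell n i `<=` D.
Hypothesis cell_triv : forall n, trivIset setT (@cell n).
Hypothesis cell_gt0 : forall n i, (0 < mu (@cell n i))%E.
Hypothesis cell_dense : forall h, mu.-integrable D (EFin \o h) ->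
  forall e : R, 0 < e -> exists N, forall n, (N <= n)%N ->
  exists a : 'I_n.+1 -> R, \int[mu]_(y in D) `|h y - cell_step cell a y| <= e.
Variables (w : T -> T -> R) (beta : R -> R) (M L : R).
Hypothesis w_L2 : in_L2 (mu \x mu)%E (D `*` D) (fun p => w p.1 p.2).
Hypothesis M0 : 0 < M.
Hypothesis L0 : 0 <= L.
Hypothesis beta_bounded : forall t, `|beta t| <= M.
Hypothesis beta_lip : forall s t, `|beta s - beta t| <= L * `|s - t|.

Let D_fin : (mu D < +oo)%E. Proof. by rewrite muD ltry. Qed.

Let DD_fin : ((mu \x mu) (D `*` D) < +oo)%E.
Proof. by rewrite product_measure1E// lte_mul_pinfty// ge0_fin_numE. Qed.

Let mDD : measurable (D `*` D). Proof. exact: measurableX. Qed.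

Lemma in_L2_integrable d' (X : measurableType d')
    (nu : {measure set X -> \bar R}) (E : set X) (f : X -> R) :
  measurable E -> (nu E < +oo)%E -> in_L2 nu E f -> nu.-integrable E (EFin \o f).
Proof.
move=> mE Efin /(in_L2P nu mE)[mf f2].
apply: (@le_integrable _ _ _ nu E mE _ (EFin \o (fun x => 1 + f x ^+ 2))).
- exact/measurable_EFinP.
- move=> x _; rewrite /= lee_fin -(real_normK (num_real (f x))).
  rewrite [leRHS]ger0_norm ?addr_ge0 ?exprn_ge0//.
  by have := sqr_ge0 (`|f x| - 1); have := normr_ge0 (f x); nra.
- by apply: L1D => //; exact: L1_cst.
Qed.

(** Jensen's inequality on a space of mass 1: the variance is nonnegative. *)
Lemma Rintegral_sqr_le (g : T -> R) : mu.-integrable D (EFin \o g) ->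
  mu.-integrable D (EFin \o (fun y => g y ^+ 2)) ->
  (\int[mu]_(y in D) g y) ^+ 2 <= \int[mu]_(y in D) g y ^+ 2.
Proof.
move=> g1 g2; pose m := \int[mu]_(y in D) g y.
have D1 k : \int[mu]_(y in D) k = k
    by rewrite Rintegral_cst// -[RHS]mulr1; congr (_ * _); exact: (congr1 fine muD).
have : 0 <= \int[mu]_(y in D) (g y ^+ 2 - (2 * m * g y - m ^+ 2)).
  by apply: Rintegral_ge0 => y _; have := sqr_ge0 (g y - m); nra.
have i1 := L1Z mD (2 * m) g1.
have i2 := L1_cst mD D_fin (m ^+ 2).
rewrite !RintegralB//; last exact: L1B.
by rewrite RintegralZl// D1 -/m; lra.
Qed.

(** Almost every row of an L^2 kernel is integrable and square-integrable.
    Replacing the other rows by 0 gives a kernel to which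
    [hammerstein_solution] applies and changes the equation only on a null set.
    The solution is in L^2 because its square is bounded by [M ^+ 2] times the
    integral of the squared row. *)
Theorem L2_hammerstein_solution : exists z : T -> R, in_L2 mu D z /\
  {ae mu, forall x, D x -> z x = \int[mu]_(y in D) (w x y * beta (z y))}.
Proof.
have [mw w2] := (in_L2P _ mDD _).1 w_L2.
have w1 := in_L2_integrable mDD DD_fin w_L2.
have [N [mN N0 badN]] : {ae mu, forall x, D x ->
    mu.-integrable D (EFin \o w x) /\ mu.-integrable D (EFin \o (fun y => w x y ^+ 2))}.
  apply: filterS2 (ae_section_L1 mD w1) (ae_section_L1 mD w2) => x h1 h2 Dx.
  by split; [exact: h1|exact: h2].
have good x : D x -> ~ N x ->
    mu.-integrable D (EFin \o w x) /\ mu.-integrable D (EFin \o (fun y => w x y ^+ 2)).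
  by move=> Dx Nx; apply: contrapT => bad; apply/Nx/badN => /(_ Dx).
(* [N] contains the rows that fail to be integrable or square-integrable. *)
pose k x y := w x y * \1_(D `\` N) x.
have k_good x : D x -> ~ N x -> k x = w x.
  by move=> Dx Nx; apply/funext => y; rewrite /k indicE mem_set ?mulr1.
have k_bad x : N x -> k x = fun=> 0.
  by move=> Nx; apply/funext => y; rewrite /k indicE memNset ?mulr0// => -[].
have k_L1 x : mu.-integrable D (EFin \o k x).
  have [[Dx Nx]|nx] := pselect ((D `\` N) x); first by rewrite k_good//; have [] := good x Dx Nx.
  have -> : k x = fun=> 0 by apply/funext => y; rewrite /k indicE memNset ?mulr0.
  exact: L1_cst.
have mDN : measurable (D `\` N) by exact: measurableD.
have k_meas n (i : 'I_n.+1) : measurable_fun D (fun x => \int[mu]_(y in cell i) k x y).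
  have ic : (mu \x mu)%E.-integrable (D `*` D) (EFin \o (fun p => w p.1 p.2 * \1_(cell i) p.2)).
    apply: (@L1_mul_bounded _ _ _ _ _ mDD _ _ 1) => // [|y].
      by apply: measurable_funTS; apply: measurableT_comp => //; exact: measurable_indic.
    by rewrite indicE; case: (_ \in _); rewrite ?normr1 ?normr0.
  apply: (@eq_measurable_fun _ _ _ _ D
    (fun x => (\int[mu]_(y in D) (w x y * \1_(cell i) y)) * \1_(D `\` N) x)).
    move=> x /set_mem Dx; have [Nx|Nx] := pselect (N x).
      by rewrite k_bad// indicE memNset ?mulr0 ?Rintegral_cst ?mul0r// => -[].
    by rewrite k_good// indicE mem_set// mulr1 (Rintegral_cell _ cellD).
  apply: measurable_funM; last exact: measurable_indic.
  exact: (measurable_section_Rintegral mD ic).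
have k_rows : mu.-integrable D (EFin \o (fun x => \int[mu]_(y in D) `|k x y|)).
  apply: (@eq_integrable _ _ _ mu D mD
    (EFin \o (fun x => (\int[mu]_(y in D) `|w x y|) * \1_(D `\` N) x))).
    move=> x /set_mem Dx; rewrite /=; congr EFin; have [Nx|Nx] := pselect (N x).
      rewrite k_bad// indicE memNset ?mulr0 ?Rintegral_cst ?normr0 ?mul0r// => -[]//.
    by rewrite k_good// indicE mem_set// mulr1.
  apply: (@L1_mul_bounded _ _ _ _ _ mD _ _ 1) => // [|y].
    exact: (section_Rintegral_L1 mD (L1_norm w1)).
  by rewrite indicE; case: (_ \in _); rewrite ?normr1 ?normr0.
have [z [mz hz]] := hammerstein_solution mD D_fin mcell cellD cell_triv cell_gt0
  cell_dense k_L1 k_meas k_rows M0 L0 beta_bounded beta_lip.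
have mbz : measurable_fun D (fun y => beta (z y)).
  apply: measurableT_comp => //.
  exact: continuous_measurable_fun (lipschitz_continuous L0 beta_lip).
exists z; split; last first.
  exists N; split => // x /= bad; apply: contrapT => Nx; apply: bad => Dx.
  by rewrite hz// k_good.
apply/(in_L2P mu mD); split => //.
apply: (@le_integrable _ _ _ mu D mD _ (EFin \o (fun x => M ^+ 2 * \int[mu]_(y in D) w x y ^+ 2))).
- exact/measurable_EFinP/measurable_funX.
- move=> x Dx; rewrite /= lee_fin ger0_norm ?sqr_ge0// ger0_norm; last first.
    by rewrite mulr_ge0 ?sqr_ge0// Rintegral_ge0// => y _; exact: sqr_ge0.
  have [Nx|Nx] := pselect (N x).
    rewrite hz// k_bad// (_ : \int[mu]_(y in D) _ = 0); last first.
      by rewrite (@eq_Rintegral _ _ _ _ _ (fun=> 0)) ?Rintegral_cst ?mul0r// => y _; rewrite mul0r.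
    by rewrite expr0n/= mulr_ge0 ?sqr_ge0// Rintegral_ge0// => y _; exact: sqr_ge0.
  have [g1 g2] := good x Dx Nx.
  rewrite hz// k_good//.
  have isq : mu.-integrable D (EFin \o (fun y => (w x y * beta (z y)) ^+ 2)).
    apply: (@eq_integrable _ _ _ mu D mD (EFin \o (fun y => w x y ^+ 2 * beta (z y) ^+ 2))).
      by move=> y _; rewrite /= exprMn.
    apply: (@L1_mul_bounded _ _ _ _ _ mD _ _ (M ^+ 2)) => // [|y]; first exact: measurable_funX.
    by rewrite normrX lerXn2r ?nnegrE ?(ltW M0)//.
  apply: le_trans (Rintegral_sqr_le _ isq) _.
    exact: (L1_mul_bounded mD g1 mbz (fun=> beta_bounded _)).
  rewrite -RintegralZl//; apply: le_Rintegral => //; first exact: L1Z.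
  move=> y _; rewrite exprMn mulrC ler_wpM2r ?sqr_ge0//.
  by rewrite -(real_normK (num_real (beta _))) lerXn2r ?nnegrE ?(ltW M0)//.
- exact: L1Z (section_Rintegral_L1 mD w2).
Qed.

End L2_kernel.

(** * Uniqueness of the aggregate *)

Section composition.
Context d (T : measurableType d) (R : realType) (D : set T).
Hypothesis mD : measurable D.

(** Rounding [v] to a grid of mesh [1 / (n + 1)] makes the composition
    measurable, countably many sections of [B] being involved; the Lipschitz
    bound in the second variable makes the error at most [K / (n + 1)]. *)
Lemma measurable_caratheodory (B : R -> R -> R) (K : R) (u v : T -> R) :
  (forall r, continuous (B ^~ r)) ->
  (forall t r r', `|B t r - B t r'| <= K * `|r - r'|) ->
  measurable_fun D u -> measurable_fun D v ->
  measurable_fun D (fun y => B (u y) (v y)).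
Proof.
move=> cB lipB mu_ mv.
have K0 : 0 <= K.
  by have := lipB 0 1 0; rewrite subr0 normr1 mulr1; exact: le_trans.
pose grid n (k : int) : R := k%:~R / n.+1%:R.
pose fl n y : int := Num.floor (v y * n.+1%:R).
have grid_near n y : `|grid n (fl n y) - v y| <= harmonic n.
  have n0 : 0 < n.+1%:R :> R by [].
  have /andP[h1 h2] := floor_itv (v y * n.+1%:R).
  have -> : grid n (fl n y) - v y = ((fl n y)%:~R - v y * n.+1%:R) / n.+1%:R.
    by rewrite mulrBl mulfK// gt_eqF.
  rewrite normrM normfV (gtr0_norm n0) ler_pdivrMr//= mulVf ?gt_eqF// distrC.
  rewrite ger0_norm ?subr_ge0// lerBlDl (le_trans (ltW h2))//.
  by rewrite intrD addrC.
apply: (measurable_fun_cvg (h := fun n y => B (u y) (grid n (fl n y)))); last first.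
  move=> y _; apply/cvgrPdist_le => e e0.
  have K1 : 0 < K + 1 by rewrite ltr_wpDl.
  have eK : 0 < e / (K + 1) by rewrite divr_gt0.
  have /cvgrPdist_le/(_ _ eK) := @cvg_harmonic R.
  apply: filterS => n; rewrite sub0r normrN ger0_norm ?harmonic_ge0// => hn.
  rewrite (le_trans (lipB _ _ _))// distrC.
  have h := le_trans (grid_near n y) hn.
  rewrite (le_trans (ler_wpM2l K0 h))// mulrCA ler_piMr ?(ltW e0)//.
  by rewrite ler_pdivrMr// mul1r lerDl.
move=> n _ Y mY.
pose S (k : int) := (D `&` v @^-1` `[grid n k, grid n (k + 1)[%classic) `&`
  (D `&` (fun y => B (u y) (grid n k)) @^-1` Y).
have mS k : measurable (S k).
  apply: measurableI; first by apply: mv => //; exact: measurable_itv.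
  have mB : measurable_fun setT (B ^~ (grid n k)) := continuous_measurable_fun (cB _).
  exact: (measurableT_comp mB mu_).
have -> : D `&` (fun y => B (u y) (grid n (fl n y))) @^-1` Y =
    \bigcup_j (if unpickle j is Some k then S k else set0).
  apply/seteqP; split => [y [Dy Yy]|y [j _]].
    exists (pickle (fl n y)); [exact: I|rewrite pickleK; split; split => //=].
    rewrite in_itv/= ler_pdivrMr// ltr_pdivlMr//.
    exact: floor_itv.
  case: unpickle => // k [[Dy]] /=; rewrite in_itv/= ler_pdivrMr// ltr_pdivlMr// => h [_ Yy].
  by split => //=; rewrite /fl (floor_def h).
by apply: bigcupT_measurable => j; case: unpickle.
Qed.

End composition.

Section contraction.
Context d (T : measurableType d) (R : realType)
  (mu : {sigma_finite_measure set T -> \bar R}) (D : set T).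
Hypothesis mD : measurable D.
Hypothesis muD : mu D = 1%E.
Variables (w : T -> T -> R) (phi : T -> R -> R) (M c : R) (opn : \bar R).
Hypothesis w_L2 : in_L2 (mu \x mu)%E (D `*` D) (fun p => w p.1 p.2).
Hypothesis c0 : 0 <= c.
Hypothesis phi_meas : forall v, measurable_fun D v -> measurable_fun D (fun y => phi y (v y)).
Hypothesis phi_bounded : forall y r, `|phi y r| <= M.
Hypothesis phi_lip : forall y r r', `|phi y r - phi y r'| ^+ 2 <= c * `|r - r'| ^+ 2.
Hypothesis opnP : forall g, in_L2 mu D g -> (normL2 mu D g <= 1)%E ->
  (normL2 mu D (fun x => (\int[mu]_(y in D) (w x y * g y))%R) <= opn)%E.
Hypothesis contr : ((Num.sqrt c)%:E * opn < 1)%E.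

(** The difference [dz] of two solutions is [W g] almost everywhere, with
    [\int g ^+ 2 <= c * \int dz ^+ 2]. If [g] is not null, testing the operator
    norm on [g] normalized gives
    [sqrt c * opn >= sqrt (c * \int dz ^+ 2 / \int g ^+ 2) >= 1]. *)
Lemma contraction_unique (z z' : T -> R) : in_L2 mu D z -> in_L2 mu D z' ->
  {ae mu, forall x, D x -> z x = \int[mu]_(y in D) (w x y * phi y (z y))} ->
  {ae mu, forall x, D x -> z' x = \int[mu]_(y in D) (w x y * phi y (z' y))} ->
  {ae mu, forall x, D x -> z' x = z x}.
Proof.
move=> zL2 zL2' ez ez'.
have D_fin : (mu D < +oo)%E by rewrite muD ltry.
have mDD : measurable (D `*` D) by exact: measurableX.
have DD_fin : ((mu \x mu) (D `*` D) < +oo)%E.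
  by rewrite product_measure1E// lte_mul_pinfty// ge0_fin_numE.
have [mz z2] := (in_L2P mu mD z).1 zL2.
have [mz' z2'] := (in_L2P mu mD z').1 zL2'.
have w1 := in_L2_integrable mDD DD_fin w_L2.
have aew := ae_section_L1 mD w1.
pose g y := phi y (z' y) - phi y (z y).
have mg : measurable_fun D g by apply: measurable_funB; exact: phi_meas.
have gM y : `|g y| <= M + M by rewrite (le_trans (ler_normB _ _))// lerD.
pose dz y := z' y - z y.
have mdz : measurable_fun D dz by exact: measurable_funB.
have dz2 : mu.-integrable D (EFin \o (fun y => dz y ^+ 2)).
  apply: (@le_integrable _ _ _ mu D mD _ (EFin \o (fun y => 2 * (z' y ^+ 2 + z y ^+ 2)))).
  - by apply/measurable_EFinP; exact: measurable_funX.
  - move=> y _; rewrite /= lee_fin ger0_norm ?sqr_ge0// ger0_norm.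
      by rewrite /dz; have := sqr_ge0 (z' y + z y); rewrite !expr2; lra.
    by rewrite mulr_ge0// addr_ge0// sqr_ge0.
  - by apply: L1Z => //; exact: L1D.
have g2 : mu.-integrable D (EFin \o (fun y => g y ^+ 2)).
  apply: (L1_bounded mD D_fin (M := (M + M) ^+ 2)); first exact: measurable_funX.
  by move=> y; rewrite normrX lerXn2r ?nnegrE// (le_trans _ (gM y)).
have g_dz y : g y ^+ 2 <= c * dz y ^+ 2.
  by have := phi_lip y (z' y) (z y); rewrite !real_normK ?num_real.
pose A := \int[mu]_(y in D) g y ^+ 2.
pose B := \int[mu]_(y in D) dz y ^+ 2.
have AB : A <= c * B.
  by rewrite /B -RintegralZl//; apply: le_Rintegral => //; exact: L1Z.
have A0 : 0 <= A by apply: Rintegral_ge0 => y _; exact: sqr_ge0.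
have dzW : {ae mu, forall x, D x -> mu.-integrable D (EFin \o w x) /\
    dz x = \int[mu]_(y in D) (w x y * g y)}.
  apply: filterS3 aew ez ez' => x h1 h2 h3 Dx.
  have wx : mu.-integrable D (EFin \o w x) by exact: h1.
  split => //; rewrite /dz h2// h3// -RintegralB//.
  - by apply: eq_Rintegral => y _; rewrite mulrBr.
  - exact: (L1_mul_bounded mD wx (phi_meas mz') (fun=> phi_bounded _ _)).
  - exact: (L1_mul_bounded mD wx (phi_meas mz) (fun=> phi_bounded _ _)).
(* When [g] is null it cannot be normalized, but then [W g = 0] almost
   everywhere. *)
have [A_eq0|A_neq0] := eqVneq A 0.
  have g0 : ae_eq mu D (EFin \o g) (cst 0%E).
    have : ae_eq mu D (EFin \o (fun y => g y ^+ 2)) (cst 0%E).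
      apply/ae_eq_integral_abs => //; first by apply/measurable_EFinP; exact: measurable_funX.
      rewrite (@eq_integral _ _ _ mu D (EFin \o (fun y => g y ^+ 2))); last first.
        by move=> y _; rewrite /= ger0_norm ?sqr_ge0.
      by rewrite -[LHS]fineK ?integrable_fin_num// -/A -[fine _]/A A_eq0.
    apply: filterS => y h Dy; have := h Dy; rewrite /= => -[] /eqP.
    by rewrite sqrf_eq0 => /eqP ->.
  apply: filterS dzW => x h Dx; have [wx dzx] := h Dx.
  apply/eqP; rewrite -subr_eq0 -/(dz x) dzx /Rintegral.
  rewrite (ae_eq_integral (cst 0%E)) ?integral0//.
  - exact: measurable_int (L1_mul_bounded mD wx mg gM).
  - apply: filterS g0 => y h0 Dy; have [/= gy0] := h0 Dy.
    by rewrite gy0 mulr0.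
have Agt0 : 0 < A by rewrite lt_neqAle eq_sym A_neq0.
have s0 : 0 < Num.sqrt A by rewrite sqrtr_gt0.
pose g' y := g y * (Num.sqrt A)^-1.
pose dz' y := dz y * (Num.sqrt A)^-1.
have sqr_scale (h : T -> R) : mu.-integrable D (EFin \o (fun y => h y ^+ 2)) ->
    measurable_fun D h -> in_L2 mu D (fun y => h y * (Num.sqrt A)^-1) /\
    \int[mu]_(y in D) (h y * (Num.sqrt A)^-1) ^+ 2 = A^-1 * \int[mu]_(y in D) h y ^+ 2.
  move=> h2 mh.
  have e y : (h y * (Num.sqrt A)^-1) ^+ 2 = A^-1 * h y ^+ 2.
    by rewrite exprMn exprVn sqr_sqrtr// mulrC.
  split; last by rewrite -RintegralZl//; apply: eq_Rintegral => y _; rewrite e.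
  apply/(in_L2P mu mD); split; first exact: measurable_funM.
  by under eq_fun do rewrite e; exact: L1Z.
have [g'L2 g'norm] := sqr_scale g g2 mg.
have [dz'L2 dz'norm] := sqr_scale dz dz2 mdz.
have g'M y : `|g' y| <= (M + M) * (Num.sqrt A)^-1.
  by rewrite normrM ler_pM// normfV gtr0_norm.
have mg' : measurable_fun D g' by exact: measurable_funM.
have norm_le : (normL2 mu D (fun x => (\int[mu]_(y in D) (w x y * g' y))%R) <= opn)%E.
  apply: opnP => //; rewrite normL2E// g'norm -/A mulVf// sqrtr1//.
have norm_eq : normL2 mu D (fun x => (\int[mu]_(y in D) (w x y * g' y))%R) =
    (Num.sqrt (A^-1 * B))%:E.
  rewrite -dz'norm -normL2E//; apply: eq_normL2 => //.
  - have iq : (mu \x mu)%E.-integrable (D `*` D) (EFin \o (fun p => w p.1 p.2 * g' p.2)).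
      apply: (L1_mul_bounded mDD w1 (M := (M + M) * (Num.sqrt A)^-1));
        last by move=> y; exact: g'M.
      apply: (measurable_comp mD _ mg'); last exact: measurable_funTS.
      by move=> _ [[x y] [/= _ Dy] <-].
    exact: (measurable_section_Rintegral mD iq).
  - exact: measurable_funM.
  - apply: filterS dzW => x h Dx; have [wx dzx] := h Dx.
    rewrite dzx -RintegralZr//; last exact: (L1_mul_bounded mD wx mg gM).
    by apply: eq_Rintegral => y _; rewrite mulrA.
exfalso; move: contr; apply/negP; rewrite -leNgt.
apply: le_trans (_ : (Num.sqrt c)%:E * (Num.sqrt (A^-1 * B))%:E <= _)%E; last first.
  by rewrite lee_wpmul2l ?lee_fin ?sqrtr_ge0// -norm_eq.
rewrite -EFinM lee_fin -sqrtrM// -[leLHS]sqrtr1 ler_wsqrtr//.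
by rewrite mulrCA ler_pdivlMl// mulr1.
Qed.

End contraction.

(** * Existence of a Nash equilibrium *)

Theorem theorem3p15 (R : realType)
  (A : set R) (hA0 : A !=set0) (hAclosed : closed A)
  (hAconvex : convex_set (A : set R^o))
  (d : measure_display) (Omega : measurableType d) (P : probability Omega R)
  (mu0 : probability (measurableTypeR R) R)
  (hmean : (\int[mu0]_t t%:E = 0)%E)
  (xi0 : {RV P >-> measurableTypeR R})
  (hlaw : distribution P xi0 = mu0 :> (set R -> \bar R))
  (b : R -> R -> R) (f : R -> R -> R -> R)
  (hJ : cost_well_defined P xi0 b f A)
  (c_alpha c_z ell_c ell_J c_0 : R)
  (hc_alpha : 0 <= c_alpha) (hc_z : 0 <= c_z) (hell_c : 0 < ell_c)
  (hell_J : 0 <= ell_J) (hc_0 : 0 < c_0)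
  (w : R -> R -> R) (hw : is_graphon w)
  (hb_lip : forall a a' z z', A a -> A a' ->
    `|b a z - b a' z'| ^+ 2 <= c_alpha * `|a - a'| ^+ 2 + c_z * `|z - z'| ^+ 2)
  (hxi_moment : ('E_P[(fun om => (xi0 om : R) ^+ 2)%R] < +oo)%E)
  (hJ_C1 : forall z, C1_on A (fun a => cost P xi0 b f a z))
  (hJ_convex : forall a a' z eps, A a -> A a' -> 0 <= eps -> eps <= 1 ->
    cost P xi0 b f (eps * a + (1 - eps) * a') z <=
      eps * cost P xi0 b f a z + (1 - eps) * cost P xi0 b f a' z
      - ell_c / 2 * eps * (1 - eps) * `|a - a'| ^+ 2)
  (hJ_lip : forall a z z', A a ->
    `|derive_within A (fun a' => cost P xi0 b f a' z') a
      - derive_within A (fun a' => cost P xi0 b f a' z) a| <= ell_J * `|z' - z|)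
  (hb_bounded : forall a z, A a -> `|b a z| <= c_0)
  (hcontr : ((Num.sqrt c_z)%:E * graphon_norm w < 1)%E) :
  exists alpha : R -> R, nash_equilibrium A w b (cost P xi0 b f) alpha.
Proof.
pose leb := @lebesgue_measure R.
pose J := cost P xi0 b f.
have mI := @measurable_unitI R.
have lebI := @lebesgue_unitI R.
have I_fin : (leb unitI < +oo)%E by rewrite /leb lebI ltry.
have [_ w_L2] := hw.
have Jder z a : A a -> derivable_within A (J ^~ z) a by case: (hJ_C1 z) => + _; exact.
have [resp [respA resp_min]] := lipschitz_best_response hell_c hell_J
  hA0 hAclosed (convex_set_real hAconvex) Jder hJ_convex hJ_lip.
have : 0 <= ell_J / ell_c by rewrite divr_ge0// ltW.
move: (ell_J / ell_c) => k k0 resp_lip.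
pose beta t := b (resp t) t.
pose L := Num.sqrt (c_alpha * k ^+ 2 + c_z).
have L0 : 0 <= L by exact: sqrtr_ge0.
have beta_lip s t : `|beta s - beta t| <= L * `|s - t|.
  rewrite -(@ler_pXn2r _ 2)// ?nnegrE ?mulr_ge0// exprMn sqr_sqrtr; last first.
    by rewrite addr_ge0// mulr_ge0// sqr_ge0.
  apply: le_trans (hb_lip _ _ _ _ (respA s) (respA t)) _.
  rewrite mulrDl lerD2r -mulrA ler_wpM2l// -exprMn.
  by rewrite lerXn2r ?nnegrE ?mulr_ge0//; exact: resp_lip.
have beta_bounded t : `|beta t| <= c_0 by exact: hb_bounded.
have [z [zL2 hz]] := @L2_hammerstein_solution _ _ R leb unitI (@unit_cell R) mI lebI
  (@measurable_unit_cell R) (@unit_cell_unitI R) (@trivIset_unit_cell R)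
  (@lebesgue_unit_cell_gt0 R) (@unit_cell_dense R) w beta c_0 L w_L2 hc_0 L0
  beta_bounded beta_lip.
have [mz z2] := (in_L2P leb mI z).1 zL2.
have resp_cont : continuous resp by exact: (lipschitz_continuous k0 resp_lip).
exists (resp \o z); split.
  split; last by move=> x _; exact: respA.
  apply/(in_L2P leb mI); have mresp : measurable_fun unitI (resp \o z).
    by apply: measurableT_comp => //; exact: continuous_measurable_fun.
  split => //.
  apply: (@le_integrable _ _ _ leb unitI mI _
      (EFin \o (fun x => 2 * (resp 0 ^+ 2 + k ^+ 2 * z x ^+ 2)))).
  - by apply/measurable_EFinP; exact: measurable_funX.
  - move=> x _; rewrite /= lee_fin ger0_norm ?sqr_ge0// ger0_norm; last first.
      apply: mulr_ge0 => //; apply: addr_ge0; first exact: sqr_ge0.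
      by apply: mulr_ge0; exact: sqr_ge0.
    have : (resp (z x) - resp 0) ^+ 2 <= k ^+ 2 * z x ^+ 2.
      rewrite -[leLHS]real_normK ?num_real// -exprMn -[leRHS]real_normK ?num_real//.
      rewrite lerXn2r ?nnegrE// normrM (ger0_norm k0).
      by have := resp_lip (z x) 0; rewrite subr0.
    have := sqr_ge0 (resp (z x) - 2 * resp 0).
    by set r := resp (z x); set r0 := resp 0; set q := k ^+ 2 * _; rewrite !expr2; lra.
  - exact: (L1Z mI 2 (L1D mI (L1_cst (mu := leb) mI I_fin (resp 0 ^+ 2))
      (L1Z mI (k ^+ 2) z2))).
exists z; last by apply: aeW => x _ a Aa; exact: resp_min.
split; first by split.
move=> z' [z'L2 hz'].
have [K hK] : exists K, forall t r r', `|b (resp t) r - b (resp t) r'| <= K * `|r - r'|.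
  exists (Num.sqrt c_z) => t r r'.
  rewrite -(@ler_pXn2r _ 2)// ?nnegrE ?mulr_ge0 ?sqrtr_ge0// exprMn sqr_sqrtr//.
  have := hb_lip _ _ r r' (respA t) (respA t).
  by rewrite subrr normr0 expr0n/= mulr0 add0r.
apply: (@contraction_unique _ _ R leb unitI mI lebI w (fun y r => b (resp (z y)) r)
  c_0 c_z (graphon_norm w)) => //.
- move=> v mv; apply: (measurable_caratheodory mI (K := K)
    (B := fun t r => b (resp t) r)) => //.
  move=> r; apply: (@lipschitz_continuous _ _ (Num.sqrt c_alpha * k)).
    by rewrite mulr_ge0// sqrtr_ge0.
  move=> s t.
  rewrite -(@ler_pXn2r _ 2)// ?nnegrE ?mulr_ge0 ?sqrtr_ge0// exprMn exprMn sqr_sqrtr//.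
  apply: le_trans (hb_lip _ _ _ _ (respA s) (respA t)) _.
  rewrite subrr normr0 expr0n/= mulr0 addr0 -mulrA ler_wpM2l// -exprMn.
  by rewrite lerXn2r ?nnegrE ?mulr_ge0//; exact: resp_lip.
- by move=> y r; exact: hb_bounded.
- move=> y r r'; have := hb_lip _ _ r r' (respA (z y)) (respA (z y)).
  by rewrite subrr normr0 expr0n/= mulr0 add0r.
- by move=> g gL2 g1; apply: ereal_sup_ubound; exists g.
Qed.
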